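(* Let $d\ge4$ be an even integer, let $p,m\in\mathbb{N}_0$ with $0\le m\le p$, and let $\mathbf{x},\mathbf{x}'\in\mathbb{R}^d$ be given in standard polyspherical coordinates, with $r,r',R,R'>0$ and $r\ne r'$. Then $$\begin{aligned} Q_{m-\frac12}^{p+\frac12}(\chi)&=(-1)^{\frac d2-1+m}(2\pi)^{\frac d2-1}(\chi^2-1)^{-\frac p2-\frac14}(p-m)!(p+m)!\left(\frac{rr'}{RR'}\right)^p\left(\frac{r_>^2-r_<^2}{2rr'}\right)^{p+\frac{d-1}2}\\ &\times\sum_{l_{d-2}=m}^p\Omega_{d-2}(l_{d-2},m)\sum_{l_{d-3}=l_{d-2}}^p\Omega_{d-3}(l_{d-3},l_{d-2})\cdots\sum_{l_1=l_2}^p\Omega_1(l_1,l_2)\,\frac{(-1)^{l_1}}{(p-l_1)!(l_1+p+d-2)!}\,Q_{l_1+\frac{d-3}2}^{p+\frac{d-1}2}(\zeta). \end{aligned}$$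
   Context: $\mathbb{N}_0=\{0,1,2,\ldots\}$. Standard polyspherical coordinates on $\mathbb{R}^d$: $x_j=r\sin\theta_1\cdots\sin\theta_{j-1}\cos\theta_j$ for $1\le j\le d-2$, $x_{d-1}=R\cos\phi$, $x_d=R\sin\phi$, where $R=r\sin\theta_1\cdots\sin\theta_{d-2}$, $r\ge0$, $\theta_j\in[0,\pi]$, $\phi\in[-\pi,\pi)$; primed quantities refer to $\mathbf{x}'$. Put $r_>=\max\{r,r'\}$, $r_<=\min\{r,r'\}$, $$\zeta=\frac{r^2+r'^2}{2rr'},\qquad \chi=\frac{R^2+R'^2+\sum_{j=1}^{d-2}(x_j-x_j')^2}{2RR'}.$$ For $1\le j\le d-2$ and integers $l_j\ge l_{j+1}\ge0$ (with $l_{d-1}:=m$) put $\Omega_j(l_j,l_{j+1}):=\Theta_j^d(l_j,l_{j+1};\theta_j)\,\Theta_j^d(l_j,l_{j+1};\theta_j')$, where $$\Theta_j^d(l_j,l_{j+1};\theta)=\frac{\Gamma\!\left(l_{j+1}+\frac{d-j+1}2\right)}{2l_{j+1}+d-j-1}\sqrt{\frac{2^{2l_{j+1}+d-j-1}(2l_j+d-j-1)(l_j-l_{j+1})!}{\pi\,(l_j+l_{j+1}+d-j-2)!}}\,(\sin\theta)^{l_{j+1}}\,C_{l_j-l_{j+1}}^{l_{j+1}+(d-j-1)/2}(\cos\theta)$$ and $C_n^\mu$ is the Gegenbauer polynomial. For $z>1$ the associated Legendre function of the second kind is $$Q_\nu^\mu(z)=\frac{\sqrt{\pi}\,e^{i\pi\mu}\,\Gamma(\nu+\mu+1)(z^2-1)^{\mu/2}}{2^{\nu+1}\Gamma(\nu+\frac32)z^{\nu+\mu+1}}\,{}_2F_1\!\left(\tfrac{\nu+\mu+1}{2},\tfrac{\nu+\mu+2}{2};\nu+\tfrac32;\tfrac1{z^2}\right).$$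 *)

(* Defs.v *)
From HB Require Import structures.
From mathcomp Require Import all_boot all_order all_algebra.
From mathcomp Require Import complex.
From mathcomp Require Import all_classical all_reals all_analysis.

Set Implicit Arguments.
Unset Strict Implicit.
Unset Printing Implicit Defensive.

Import Order.TTheory GRing.Theory Num.Theory.
Import numFieldNormedType.Exports.

Local Open Scope classical_set_scope.
Local Open Scope ring_scope.

(* Euler's integral; the usual Gamma function for x > 0, the only arguments at
   which it is used. *)
Definition Gamma (R : realType) (x : R) : R :=
  \int[@lebesgue_measure R]_(t in `]0%R, +oo[) (t `^ (x - 1) * expR (- t)).

(* Rising factorial a (a + 1) ... (a + n - 1). *)
Definition pochhammer (R : realType) (a : R) (n : nat) : R :=
  \prod_(i < n) (a + i%:R).

(* Gauss hypergeometric series, meaningful for `|z| < 1. *)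
Definition hyp2F1 (R : realType) (a b c z : R) : R :=
  limn (series (fun n : nat =>
    pochhammer a n * pochhammer b n / (pochhammer c n * n`!%:R) * z ^+ n)).

Definition gegenbauer (R : realType) (n : nat) (mu x : R) : R :=
  \sum_(k < n./2.+1)
    (-1) ^+ k * pochhammer mu (n - k) / (k`!%:R * (n - 2 * k)`!%:R)
    * (2 * x) ^+ (n - 2 * k).

Definition cexpi (R : realType) (t : R) : R[i] := (cos t +i* sin t)%C.

(* Associated Legendre function of the second kind, for z > 1.  It is complex
   valued because of the factor e^(i pi mu). *)
Definition legendreQ (R : realType) (nu mu z : R) : R[i] :=
  cexpi (pi * mu) *
  (Num.sqrt pi * Gamma (nu + mu + 1) * (z ^+ 2 - 1) `^ (mu / 2)
   / (2 `^ (nu + 1) * Gamma (nu + 3 / 2) * z `^ (nu + mu + 1))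
   * hyp2F1 ((nu + mu + 1) / 2) ((nu + mu + 2) / 2) (nu + 3 / 2)
       (1 / z ^+ 2))%:C%C.

(* Angles are given by theta : nat -> R with the mathematical numbering
   theta_1, ..., theta_(d-2); the other values of theta are never used.
   The entry of index i (from 0) of a row vector x is the coordinate
   x_(i+1). *)

Definition axial_radius (R : realType) (d : nat) (r : R) (theta : nat -> R)
    : R :=
  r * \prod_(1 <= k < d - 1) sin (theta k).

Definition polyspherical_coord (R : realType) (d : nat) (r : R)
    (theta : nat -> R) (phi : R) (j : nat) : R :=
  if (j <= d - 2)%N then r * (\prod_(1 <= k < j) sin (theta k)) * cos (theta j)
  else if j == (d - 1)%N then axial_radius d r theta * cos phi
  else axial_radius d r theta * sin phi.

Definition is_polyspherical (R : realType) (d : nat) (x : 'rV[R]_d) (r : R)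
    (theta : nat -> R) (phi : R) : Prop :=
  [/\ 0 <= r,
      (forall j : nat, (1 <= j <= d - 2)%N -> 0 <= theta j <= pi),
      - pi <= phi < pi
    & x = \row_(i < d) polyspherical_coord d r theta phi i.+1].

Definition zeta (R : realType) (r r' : R) : R :=
  (r ^+ 2 + r' ^+ 2) / (2 * r * r').

Definition chi (R : realType) (d : nat) (rho rho' : R) (x x' : 'rV[R]_d) : R :=
  (rho ^+ 2 + rho' ^+ 2
   + \sum_(i < d | (i < d - 2)%N) (x ord0 i - x' ord0 i) ^+ 2)
  / (2 * rho * rho').

(* For 1 <= j <= d - 2 and l' <= l none of the natural number subtractions
   truncates. *)
Definition Theta (R : realType) (d j l l' : nat) (t : R) : R :=
  Gamma (l'%:R + (d - j + 1)%:R / 2) / (2 * l' + (d - j - 1))%:R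
  * Num.sqrt (2 ^+ (2 * l' + (d - j - 1)) * (2 * l + (d - j - 1))%:R
              * (l - l')`!%:R / (pi * (l + l' + (d - j - 2))`!%:R))
  * sin t ^+ l'
  * gegenbauer (l - l') (l'%:R + (d - j - 1)%:R / 2) (cos t).

Definition Omega (R : realType) (d : nat) (theta theta' : nat -> R)
    (j l l' : nat) : R :=
  Theta d j l l' (theta j) * Theta d j l l' (theta' j).

(* nested_sum p W f j l is
     \sum_(l_j = l)^p W j l_j l * \sum_(l_(j-1) = l_j)^p W (j-1) l_(j-1) l_j *
       ... * \sum_(l_1 = l_2)^p W 1 l_1 l_2 * f l_1. *)
Fixpoint nested_sum (R : realType) (p : nat) (W : nat -> nat -> nat -> R)
    (f : nat -> R[i]) (j l : nat) : R[i] :=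
  if j is j'.+1 then
    \sum_(l <= k < p.+1) (W j k l)%:C%C * nested_sum p W f j' k
  else f l.

(* Main.v *)
Require Import Defs.
From HB Require Import structures.
From mathcomp Require Import all_boot all_order all_algebra.
From mathcomp Require Import complex.
From mathcomp Require Import all_classical all_reals all_analysis.
From mathcomp Require Import ring lra zify.
From mathcomp Require Import measurable_realfun gauss_integral.
Import Order.TTheory GRing.Theory Num.Theory.
Import numFieldNormedType.Exports.
Local Open Scope classical_set_scope.
Local Open Scope ring_scope.

(** Let X be a random variable on [-1, 1] with density proportional to
    (1 - x^2)^(nu - 1/2), and let P_n^nu(w, t) = E[(w + sqrt t X)^n].  Two facts
    about these polynomials give the theorem.

    (1) For integer k and N, Q_{k-1/2}^{N+k+1/2}(z) is an explicit factor times
    (z^2 - 1)^(-(N+k+1/2)/2) P_N^k(z, 1).  Indeed the hypergeometric series and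
    (1 - x)^(-(N+nu+1/2)) P_N^nu(1, x) satisfy the same recurrence in (N, nu),
    which reduces to the binomial series for N = 0, 1.

    (2) Expanding (z - x)^n in the Gegenbauer polynomials C_i^mu(x) and averaging
    over x = c c' + s s' X with nu = mu - 1/2, the product formula
    E[C_i(c c' + s s' X)] = C_i(c) C_i(c') / C_i(1) expresses
    P_n^{mu-1/2}(z - c c', (s s')^2) as a sum of
    C_i^mu(c) C_i^mu(c') P_{n-i}^{mu+i}(z, 1).  With mu = l_{j+1} + (d-j-1)/2 and
    the duplication formula for Gamma, this is the sum over l_j with weight
    Omega_j, and it turns z into (z - c c') / (s s').

    Performing the sums from j = 1 to d - 2 thus leads from zeta and the index
    l_1 + d/2 - 1 to chi and the index m. *)

(** * Averages of powers *)

Section MomentPolynomials.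
Variable R : realType.
Implicit Types (nu w t : R) (n : nat).

(* P_n^nu(w, t) = E[(w + sqrt t X)^n] of the header; the recursion is integration
   by parts against the density of X.  It is polynomial in t, which may be
   negative. *)
Fixpoint moment nu w t n {struct n} : R :=
  match n with
  | 0 => 1
  | n1.+1 => match n1 with
    | 0 => w
    | n2.+1 => w * moment nu w t n1
               + n1%:R / (2 * (nu + 1)) * t * moment (nu + 1) w t n2
    end
  end.

Lemma momentSS nu w t n :
  moment nu w t n.+2 = w * moment nu w t n.+1
               + n.+1%:R / (2 * (nu + 1)) * t * moment (nu + 1) w t n.
Proof. by []. Qed.

Lemma moment_homog nu w t c n :
  moment nu (c * w) (c ^+ 2 * t) n = c ^+ n * moment nu w t n.
Proof.
elim/ltn_ind: n nu => -[|[|n]] IH nu; first by rewrite mul1r.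
  by rewrite expr1.
rewrite !momentSS !IH // !(exprS _ n.+1) !(exprS _ n); ring.
Qed.

Lemma moment_t0 nu w n : moment nu w 0 n = w ^+ n.
Proof.
elim/ltn_ind: n nu => -[|[|n]] IH nu; first by [].
  by rewrite expr1.
by rewrite momentSS IH // !exprS; ring.
Qed.

(** In terms of averages: the density for [nu + 1] minus the density for [nu] is a constant times
    the second derivative of the density for [nu + 2], so two integrations by parts put the second
    derivative on the power. The induction on n uses only the recursion. *)
Lemma momentS_nu nu w t n : 0 < nu + 1 ->
  moment (nu + 1) w t n.+2 - moment nu w t n.+2 =
  - (n.+2%:R * n.+1%:R) / (4 * (nu + 1) * (nu + 2)) * t * moment (nu + 2) w t n.
Proof.
have e2 : nu + 1 + 1 = nu + 2 by ring.
elim/ltn_ind: n nu e2 => -[|[|n]] IH nu e2 nu0.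
- by rewrite !momentSS /=; field; lra.
- by rewrite !momentSS /= e2; field; lra.
have e3 : nu + 2 + 1 = nu + 3 by ring.
have e4 : nu + 1 + 2 = nu + 3 by ring.
have nu1 : 0 < nu + 1 + 1 by lra.
have /(canRL (subrK _)) E2 := IH n.+1 (ltnSn _) nu e2 nu0.
have /(canRL (subrK _)) := IH n (ltnW (ltnSn _)) (nu + 1) ltac:(ring) nu1.
rewrite e2 e4 => E1.
have E0 := momentSS (nu + 2) w t n; rewrite e3 in E0.
rewrite (momentSS (nu + 1) w t n.+2) (momentSS nu w t n.+2) e2 E2.
have -> : moment (nu + 1) w t n.+2 = moment (nu + 2) w t n.+2 +
   n.+2%:R * n.+1%:R / (4 * (nu + 2) * (nu + 3)) * t * moment (nu + 3) w t n.
  by rewrite E1; field; lra.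
rewrite E0; move: (moment _ _ _ _) (moment _ _ _ _) => A B.
field; lra.
Qed.

(** Eliminates the moment at [nu + 2] between [momentS_nu] and the recursion at [nu + 1]. *)
Lemma moment_nuE nu w t n : 0 < nu + 1 ->
  2 * (nu + 1) * moment nu w t n.+1 =
  (n.+1%:R + 2 * nu + 2) * moment (nu + 1) w t n.+1
  - n.+1%:R * w * moment (nu + 1) w t n.
Proof.
move=> nu0; case: n => [|n]; first by rewrite /=; ring.
have /(canRL (subrK _)) E := momentS_nu nu w t n nu0.
have -> : moment nu w t n.+2 = moment (nu + 1) w t n.+2 +
  n.+2%:R * n.+1%:R / (4 * (nu + 1) * (nu + 2)) * t * moment (nu + 2) w t n.
  by rewrite E; field; lra.
rewrite (momentSS (nu + 1)) (_ : nu + 1 + 1 = nu + 2); last by ring.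
by field; lra.
Qed.

(** At w = x, t = x^2 - 1 this is the three-term recurrence of the Gegenbauer polynomials. For
    positive n all terms are written through two consecutive moments at [nu + 1], and the identity
    becomes formal. *)
Lemma moment_recurrence nu w t n : 0 < nu + 1 ->
  (n%:R + 2 * nu + 2) * moment nu w t n.+2 =
  (2 * n%:R + 2 * nu + 3) * w * moment nu w t n.+1
  - n.+1%:R * (w ^+ 2 - t) * moment nu w t n.
Proof.
move=> nu0; rewrite [in LHS]momentSS; case: n => [|n].
  by rewrite /=; field; lra.
have E := momentSS nu w t n.
have E' := moment_nuE nu w t n nu0.
have -> : moment nu w t n.+1 =
  ((n.+1%:R + 2 * nu + 2) * moment (nu + 1) w t n.+1
  - n.+1%:R * w * moment (nu + 1) w t n) / (2 * (nu + 1)).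
  by rewrite -E'; field; lra.
rewrite E.
have -> : moment nu w t n.+1 =
  ((n.+1%:R + 2 * nu + 2) * moment (nu + 1) w t n.+1
  - n.+1%:R * w * moment (nu + 1) w t n) / (2 * (nu + 1)).
  by rewrite -E'; field; lra.
by field; lra.
Qed.

(* Laplace's integral: this is C_n^mu(x) / C_n^mu(1). *)
Definition ngegen mu n x := moment (mu - 1 / 2) x (x ^+ 2 - 1) n.

Lemma ngegen_recurrence mu x n : 0 < mu ->
  (n%:R + 2 * mu + 1) * ngegen mu n.+2 x =
  2 * (n%:R + mu + 1) * x * ngegen mu n.+1 x - n.+1%:R * ngegen mu n x.
Proof.
move=> mu0; have nu0 : 0 < mu - 1 / 2 + 1 by lra.
have := moment_recurrence (mu - 1 / 2) x (x ^+ 2 - 1) n nu0.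
rewrite -/(ngegen mu n x) -/(ngegen mu n.+1 x) -/(ngegen mu n.+2 x) => E.
lra.
Qed.

End MomentPolynomials.

(** * Gegenbauer polynomials *)

Section GegenbauerRec.
Variable R : realType.

Lemma pochhammerS (a : R) n : pochhammer a n.+1 = pochhammer a n * (a + n%:R).
Proof. by rewrite /pochhammer big_ord_recr. Qed.

Lemma pochhammer0 (a : R) : pochhammer a 0 = 1.
Proof. by rewrite /pochhammer big_ord0. Qed.

Lemma pochhammer_recl (a : R) n : pochhammer a n.+1 = a * pochhammer (a + 1) n.
Proof.
rewrite /pochhammer big_ord_recl addr0; congr (_ * _).
by apply: eq_bigr => i _; rewrite lift0 -natr1; ring.
Qed.

Lemma pochhammer_gt0 (a : R) n : 0 < a -> 0 < pochhammer a n.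
Proof. by move=> a0; apply: prodr_gt0 => i _; rewrite ltr_wpDr. Qed.

(** Extending the summand by 0 past half the degree lets sums of consecutive degrees share one
    range, whatever the parity. *)
Definition gegen_term n (mu x : R) k : R :=
  if (2 * k <= n)%N then
    (-1) ^+ k * pochhammer mu (n - k) / (k`!%:R * (n - 2 * k)`!%:R)
    * (2 * x) ^+ (n - 2 * k)
  else 0.

Lemma gegenbauerE n N (mu x : R) : (n./2 < N)%N ->
  gegenbauer n mu x = \sum_(k < N) gegen_term n mu x k.
Proof.
move=> nN; have leN : (n./2.+1 <= N)%N := nN.
have := @big_ord_widen _ _ (+%R : R -> R -> R) _ N (gegen_term n mu x) leN.
rewrite /gegenbauer (eq_bigr (fun k : 'I_n./2.+1 => gegen_term n mu x k)); last first.
  by move=> k _; have lt_k := ltn_ord k; rewrite /gegen_term ifT //; lia.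
move=> ->; rewrite big_mkcond /=; apply: eq_bigr => k _.
by case: ltnP => // lt_nk; rewrite /gegen_term ifF //; lia.
Qed.

Lemma fact_natr_neq0 n : (n`!%:R : R) != 0.
Proof. by rewrite pnatr_eq0 -lt0n fact_gt0. Qed.

Lemma gegen_term_recurrence n (mu x : R) k : 
  n.+2%:R * gegen_term n.+2 mu x k.+1 =
  2 * (n%:R + mu + 1) * x * gegen_term n.+1 mu x k.+1
  - (n%:R + 2 * mu) * gegen_term n mu x k.
Proof.
rewrite /gegen_term; have [kn|nk] := leqP (2 * k) n; last first.
  by rewrite !ifF ?mulr0 ?subr0 //; lia.
have [q nE] : exists q, n = (2 * k + q)%N by exists (n - 2 * k)%N; lia.
have -> : (2 * k.+1 <= n.+2)%N by lia.
rewrite nE; have -> : ((2 * k + q).+2 - k.+1 = (k + q).+1)%N by lia.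
have -> : ((2 * k + q).+2 - 2 * k.+1 = q)%N by lia.
have -> : (2 * k + q - k = k + q)%N by lia.
have -> : (2 * k + q - 2 * k = q)%N by lia.
have -> : ((2 * k + q).+1 - k.+1 = k + q)%N by lia.
have -> : ((2 * k + q).+1 - 2 * k.+1 = q.-1)%N by lia.
have k0 := fact_natr_neq0 k; have k1 : (k%:R + 1 : R) != 0 by rewrite natr1 pnatr_eq0.
case: q => [|q] in nE *; [rewrite ifF; last lia|rewrite ifT; last lia].
  rewrite pochhammerS !addn0 factS /= exprS natrM -!natr1 natrM.
  by field; apply/andP.
have q0 := fact_natr_neq0 q; have q1 : (q%:R + 1 : R) != 0 by rewrite natr1 pnatr_eq0.
rewrite pochhammerS !factS /= !exprS !natrM.
move: (natrD R (2 * k) q.+1) (natrD R k q.+1); rewrite natrM => E1 E2.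
rewrite -!natr1 E1 E2 -!natr1.
field; apply/and4P; split=> //.
Qed.

Lemma gegenbauer_recurrence n (mu x : R) :
  n.+2%:R * gegenbauer n.+2 mu x =
  2 * (n%:R + mu + 1) * x * gegenbauer n.+1 mu x
  - (n%:R + 2 * mu) * gegenbauer n mu x.
Proof.
rewrite (gegenbauerE n.+2 n.+3); last lia.
rewrite (gegenbauerE n.+1 n.+3); last lia.
rewrite (gegenbauerE n n.+2); last lia.
rewrite big_ord_recl [in RHS]big_ord_recl !mulrDr !mulr_sumr.
under eq_bigr do rewrite lift0 gegen_term_recurrence.
rewrite sumrB addrA; congr (_ + _ - _).
  (* The leading terms are compared apart: the degree n sum enters with its index shifted by one and
     contributes nothing to them. *)
  have term0 k : gegen_term k mu x 0 = pochhammer mu k / k`!%:R * (2 * x) ^+ k.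
    by rewrite /gegen_term muln0 /= !subn0 expr0 fact0 !mul1r.
  rewrite /= !term0 !factS pochhammerS !exprS !natrM.
  have := fact_natr_neq0 n; rewrite -!natr1 => n0.
  by field; rewrite n0 /= !natr1 !pnatr_eq0.
by apply: eq_bigr => i _; rewrite lift0; ring.
Qed.

End GegenbauerRec.

Section GegenbauerExpansion.
Variable R : realType.
Implicit Types (mu z x : R).

Lemma natr_bin_diag n i : (i <= n)%N ->
  (n - i)%:R * 'C(n, i)%:R = i.+1%:R * 'C(n, i.+1)%:R :> R.
Proof. by move=> le_in; rewrite -!natrM mul_bin_left. Qed.

(** This compares the coefficients of the degree i Gegenbauer polynomial in (z - x)^(n+1) = (z - x)
    (z - x)^n: multiplication by x brings in the degrees i - 1 and i + 1. *)
Lemma moment_expansion_coef mu z n i : 0 < mu -> (i <= n.+1)%N ->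
  'C(n.+1, i)%:R * moment R (mu + i%:R) z 1 (n.+1 - i) =
  'C(n, i)%:R * z * moment R (mu + i%:R) z 1 (n - i)
  + (if i is i'.+1 then 'C(n, i')%:R * moment R (mu + i'%:R) z 1 (n - i') else 0)
  + 'C(n, i.+1)%:R * (2 * mu + i%:R) * i.+1%:R
    / (4 * (mu + i%:R) * (mu + i.+1%:R)) * moment R (mu + i.+1%:R) z 1 (n - i.+1).
Proof.
move=> mu0; case: i => [_|i].
  rewrite !bin0 bin1 !subn0 !addr0; case: n => [|n]; first by rewrite /=; ring.
  by rewrite subn1 momentSS /=; field; lra.
have i0 : (0 : R) <= i%:R by [].
(* At the two top indices a truncated subtraction is paired with a vanishing binomial coefficient;
   they are treated separately. *)
rewrite ltnS leq_eqVlt => /predU1P[->|].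
  by rewrite !subnn !binn !bin_small ?(leqnn, leqnSn) //=; ring.
rewrite leq_eqVlt => /predU1P[iE|].
  rewrite -iE !(subnn, subSnn) !binn binSn (@bin_small _ i.+2) ?leqnn //.
  by rewrite (binSn i) /= -!natr1; ring.
move=> lt_in; have [k nE] : exists k, n = (i + k.+2)%N by exists (n - i.+2)%N; lia.
have B1 := natr_bin_diag n i ltac:(lia); have B2 := natr_bin_diag n i.+1 ltac:(lia).
rewrite binS natrD.
have -> : (n.+1 - i.+1 = k.+2)%N by lia.
have e1 : (n - i.+1 = k.+1)%N by lia.
have e2 : (n - i = k.+2)%N by lia.
have -> : (n - i.+2 = k)%N by lia.
rewrite e1 e2 in B1 B2 *.
have /(canRL (subrK _)) := momentS_nu R (mu + i%:R) z 1 k ltac:(lra).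
have S := momentSS R (mu + i.+1%:R) z 1 k.
have f1 : mu + i.+1%:R = mu + i%:R + 1 by rewrite -natr1; ring.
have f2 : mu + i.+2%:R = mu + i%:R + 2 by rewrite -!natr1; ring.
have f3 : mu + i%:R + 1 + 1 = mu + i%:R + 2 by ring.
rewrite f1 f3 in S; rewrite f1 f2 => E.
have -> : moment R (mu + i%:R) z 1 k.+2 = moment R (mu + i%:R + 1) z 1 k.+2 +
   k.+2%:R * k.+1%:R / (4 * (mu + i%:R + 1) * (mu + i%:R + 2)) *
   moment R (mu + i%:R + 2) z 1 k by rewrite E; field; lra.
have -> : 'C(n, i.+2)%:R = k.+1%:R * 'C(n, i.+1)%:R / i.+2%:R :> R.
  by rewrite B2 mulrAC divff ?mul1r // pnatr_eq0.
have -> : 'C(n, i)%:R = i.+1%:R * 'C(n, i.+1)%:R / k.+2%:R :> R.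
  by rewrite -B1 mulrAC divff ?mul1r // pnatr_eq0.
rewrite S; have k0 : (0 : R) <= k%:R by [].
by rewrite -!natr1; field; lra.
Qed.

(** This is (-1)^i divided by the leading coefficient of C_i^mu(x) / C_i^mu(1), as the top degree
    term of (z - x)^i requires. *)
Definition expansion_weight mu i : R :=
  (-1) ^+ i * pochhammer (2 * mu) i / (2 ^+ i * pochhammer mu i).

Lemma expansion_weightS mu i : 0 < mu -> expansion_weight mu i.+1 =
  - expansion_weight mu i * (2 * mu + i%:R) / (2 * (mu + i%:R)).
Proof.
move=> mu0; rewrite /expansion_weight !pochhammerS !exprS.
have p0 := pochhammer_gt0 _ mu i mu0; have i0 : (0 : R) <= i%:R by [].
have : (2 : R) ^+ i != 0 by rewrite expf_neq0.
by move=> h; field; rewrite h /= !gt_eqF //; lra.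
Qed.

(** Induction on n: the three-term recurrence turns multiplication by x into shifts of the degree by
    one in both directions, and [moment_expansion_coef] collects the results. *)
Lemma ngegen_expansion mu z x n : 0 < mu ->
  (z - x) ^+ n = \sum_(i < n.+1) 'C(n, i)%:R * expansion_weight mu i
     * moment R (mu + i%:R) z 1 (n - i) * ngegen R mu i x.
Proof.
move=> mu0; elim: n => [|n IH].
  by rewrite big_ord1 /expansion_weight !pochhammer0 /ngegen /= bin0; field.
set e := expansion_weight mu; set M := fun i j => moment R (mu + i%:R) z 1 j.
set g := ngegen R mu ^~ x.
have xg i : x * g i = ((i%:R + 2 * mu) * g i.+1 + i%:R * g i.-1) / (2 * (i%:R + mu)).
  have i0 : (0 : R) <= i%:R by [].
  case: i i0 => [|i] i0; first by rewrite /g /ngegen /=; field; lra.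
  have E : (i%:R + 2 * mu + 1) * g i.+2 =
    2 * (i%:R + mu + 1) * x * g i.+1 - (i%:R + 1) * g i.
    by have := ngegen_recurrence R mu x i mu0; rewrite natr1.
  rewrite /= -natr1 in i0 *.
  have -> : g i.+2 = (2 * (i%:R + mu + 1) * x * g i.+1 - (i%:R + 1) * g i) /
    (i%:R + 2 * mu + 1) by rewrite -E; field; lra.
  by field; lra.
rewrite exprS IH mulrBl !mulr_sumr.
have -> : \sum_(i < n.+1) z * ('C(n, i)%:R * e i * M i (n - i)%N * g i) =
   \sum_(i < n.+2) z * ('C(n, i)%:R * e i * M i (n - i)%N * g i).
  by rewrite [RHS]big_ord_recr /= bin_small // !mul0r mulr0 addr0.
(* The raising and lowering parts of x g_i are reindexed by the resulting degree and padded with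
   zero terms to a common range. *)
have -> : \sum_(i < n.+1) x * ('C(n, i)%:R * e i * M i (n - i)%N * g i) =
   - \sum_(i < n.+2) (if (i : nat) is i'.+1 then 'C(n, i')%:R * e i'.+1 * M i' (n - i')%N * g i'.+1 else 0)
   - \sum_(i < n.+2) 'C(n, i.+1)%:R * (2 * mu + i%:R) * i.+1%:R
    / (4 * (mu + i%:R) * (mu + i.+1%:R)) * e i * M i.+1 (n - i.+1)%N * g i.
  have -> : \sum_(i < n.+2) 'C(n, i.+1)%:R * (2 * mu + i%:R) * i.+1%:R
    / (4 * (mu + i%:R) * (mu + i.+1%:R)) * e i * M i.+1 (n - i.+1)%N * g i =
    \sum_(i < n) 'C(n, i.+1)%:R * (2 * mu + i%:R) * i.+1%:R
    / (4 * (mu + i%:R) * (mu + i.+1%:R)) * e i * M i.+1 (n - i.+1)%N * g i.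
    by rewrite 2!big_ord_recr /= !bin_small ?leqnSn // !mul0r !addr0.
  have -> : \sum_(i < n) 'C(n, i.+1)%:R * (2 * mu + i%:R) * i.+1%:R
    / (4 * (mu + i%:R) * (mu + i.+1%:R)) * e i * M i.+1 (n - i.+1)%N * g i =
    - \sum_(i < n.+1) 'C(n, i)%:R * e i * M i (n - i)%N * (i%:R * g i.-1 / (2 * (i%:R + mu))).
    rewrite [in RHS]big_ord_recl /= !mul0r mulr0 add0r -sumrN.
    apply: eq_bigr => i _; rewrite /bump /= add1n /e expansion_weightS //.
    have i0 : (0 : R) <= i%:R by [].
    by rewrite -natr1; field; lra.
  rewrite opprK [in RHS]big_ord_recl /= add0r -sumrN -big_split /=.
  apply: eq_bigr => i _; rewrite /bump /= ?add1n mulrCA xg /e expansion_weightS //.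
  have i0 : (0 : R) <= i%:R by [].
  by field; lra.
rewrite opprD !opprK addrA -!big_split /=; apply: eq_bigr => -[i lt_in] _ /=.
rewrite -/(M i _) /M; have := moment_expansion_coef mu z n i mu0 lt_in.
rewrite -/(M i (n.+1 - i)%N) -/(M i (n - i)%N) -/(M i.+1 (n - i.+1)%N).
have -> : 'C(n.+1, i)%:R * e i * M i (n.+1 - i)%N * g i =
  'C(n.+1, i)%:R * M i (n.+1 - i)%N * (e i * g i) by ring.
move=> ->; case: i lt_in => [|i] _; ring.
Qed.

End GegenbauerExpansion.

(** * The product formula *)

Section ProductFormula.
Variable R : realType.
Implicit Types (nu mu a b c w t : R) (f p W T : {poly R}).

Lemma poly_ext f p : (forall x, f.[x] = p.[x]) -> f = p.
Proof.
move=> fp; apply/eqP; rewrite -subr_eq0; apply/negPn/negP => q0.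
pose rs : seq R := [seq i%:R | i <- iota 0 (size (f - p))].
have rs_roots : all (root (f - p)) rs.
  by apply/allP => x _; rewrite rootE hornerD hornerN fp subrr.
have rs_uniq : uniq rs.
  by rewrite map_inj_uniq ?iota_uniq // => i j /eqP; rewrite eqr_nat => /eqP.
have := max_poly_roots q0 rs_roots rs_uniq.
by rewrite size_map size_iota ltnn.
Qed.

(** [moment] with polynomial arguments, kept as a polynomial so that it can be differentiated
    formally. *)
Fixpoint mompoly W T nu n {struct n} : {poly R} :=
  match n with
  | 0 => 1
  | n1.+1 => match n1 with
    | 0 => W
    | n2.+1 => W * mompoly W T nu n1
               + (n1%:R / (2 * (nu + 1))) *: (T * mompoly W T (nu + 1) n2)
    end
  end.

Lemma mompolySS W T nu n : mompoly W T nu n.+2 = W * mompoly W T nu n.+1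
   + (n.+1%:R / (2 * (nu + 1))) *: (T * mompoly W T (nu + 1) n).
Proof. by []. Qed.

Lemma horner_mompoly W T nu n x :
  (mompoly W T nu n).[x] = moment R nu W.[x] T.[x] n.
Proof.
elim/ltn_ind: n nu => -[|[|n]] IH nu //; first by rewrite hornerC.
by rewrite mompolySS !hornerE !IH // momentSS mulrA.
Qed.

Lemma deriv_mompoly W T nu n : 0 < nu + 1 ->
  (mompoly W T nu n)^`() =
  n%:R *: (W^`() * mompoly W T nu n.-1)
  + (n%:R * n.-1%:R / (4 * (nu + 1))) *: (T^`() * mompoly W T (nu + 1) n.-2).
Proof.
elim/ltn_ind: n nu => -[|[|n]] IH nu nu0.
- by rewrite /= derivC !mul0r !scale0r addr0.
- by rewrite /= mulr0 mul0r scale0r addr0 scale1r mulr1.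
have nu1 : 0 < nu + 1 + 1 by lra.
rewrite mompolySS derivD derivM derivZ derivM !IH //.
have predE k : k.+1.-1 = k by [].
rewrite !predE.
apply: poly_ext => x; rewrite !(hornerD, hornerZ, hornerM) !horner_mompoly.
have e2 : nu + 1 + 1 = nu + 2 by ring.
move: (W.[x]) (T.[x]) (W^`().[x]) (T^`().[x]) => w t w' t'.
rewrite e2; case: n {IH} => [|[|n]]; first by rewrite /=; field; lra.
  by rewrite /= ?e2; field; lra.
rewrite !predE.
rewrite (momentSS R nu w t n.+1) (momentSS R (nu + 1) w t n) e2.
by rewrite -!natr1; field; lra.
Qed.

(* Gegenbauer's differential operator, of which C_n^mu is an eigenvector with
   eigenvalue - n (n + 2 mu). *)
Definition gegen_op mu p : {poly R} :=
  (1 - 'X^2) * p^`()^`() - (2 * mu + 1) *: ('X * p^`()).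

Lemma gegen_op_is_linear mu : linear (gegen_op mu).
Proof.
move=> k u v; apply: poly_ext => x.
rewrite /gegen_op !(derivD, derivZ).
rewrite !(hornerD, hornerN, hornerZ, hornerM, hornerXn, hornerX, hornerC). ring.
Qed.

HB.instance Definition _ mu := GRing.isLinear.Build R {poly R} {poly R} _
  (gegen_op mu) (gegen_op_is_linear mu).

(* For a = cos t and b = (sin t)^2, the average of (a x + sqrt (b (1 - x^2)) X)^n
   as a polynomial in x. *)
Definition translate_pow a b nu n := mompoly (a *: 'X) (b *: (1 - 'X^2)) nu n.

Lemma horner_translate_pow a b nu n x :
  (translate_pow a b nu n).[x] = moment R nu (a * x) (b * (1 - x ^+ 2)) n.
Proof. by rewrite horner_mompoly !hornerE. Qed.

(** If a^2 + b = 1 the coefficients are those of [gegen_op] on the monomial of degree n, so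
    replacing monomials by [translate_pow] commutes with the operator. If a^2 + b = 0 the result is
    an eigenvector. *)
Lemma gegen_op_translate_pow a b mu n : 0 < mu ->
  gegen_op mu (translate_pow a b (mu - 1 / 2) n) =
  ((a ^+ 2 + b) * n%:R * n.-1%:R) *: translate_pow a b (mu - 1 / 2) n.-2
  - (n%:R * (n%:R + 2 * mu)) *: translate_pow a b (mu - 1 / 2) n.
Proof.
move=> mu0; set nu := mu - 1 / 2; have nu0 : 0 < nu + 1 by rewrite /nu; lra.
have -> : mu = nu + 1 / 2 by rewrite /nu; ring.
have nu1 : 0 < nu + 1 + 1 by lra.
apply: poly_ext => x; rewrite /gegen_op /translate_pow.
rewrite deriv_mompoly // derivD !derivZ !derivM !deriv_mompoly //.
rewrite !(derivZ, derivB, derivM, derivX, derivXn, derivC, derivMn).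
rewrite !(hornerD, hornerN, hornerZ, hornerM, hornerXn, hornerX, hornerC, hornerMn) !horner_mompoly.
rewrite !(hornerD, hornerN, hornerZ, hornerM, hornerXn, hornerX, hornerC).
have e2 : nu + 1 + 1 = nu + 2 by ring.
have e3 : nu + 2 + 1 = nu + 3 by ring.
rewrite e2.
have predE k : k.+1.-1 = k by [].
(* The second derivative involves a moment of degree n - 4, so the degrees below 4 are computed
   directly. *)
case: n => [|[|[|[|n]]]].
- by rewrite /=; ring.
- by rewrite /=; ring.
- by rewrite /= ?e2 ?e3; field; lra.
- by rewrite /= ?e2 ?e3; field; lra.
set w := a * x; set t := b * (1 - x ^+ 2).
have A := momentS_nu R nu w t n nu0.
have B := momentSS R nu w t n.+2.
have C := momentSS R nu w t n.+1.
have D := moment_recurrence R nu w t n.+2 nu0.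
rewrite !predE; have i0 : (0 : R) <= n%:R by [].
(* The multipliers below are read off the coefficients of M0, M1, M2 and N4. *)
have comb (k1 k2 k3 k4 u1 u2 u3 u4 v1 v2 v3 v4 u v : R) :
    u1 = v1 -> u2 = v2 -> u3 = v3 -> u4 = v4 ->
    u - v = k1 * (u1 - v1) + k2 * (u2 - v2) + k3 * (u3 - v3) + k4 * (u4 - v4) ->
    u = v.
  by move=> -> -> -> ->; rewrite !subrr !mulr0 !addr0 => /eqP; rewrite subr_eq0 => /eqP.
apply: (comb (n.+4%:R * n.+3%:R * b * x ^+ 2) n.+4%:R (2 * n.+4%:R * n.+3%:R * w)
  n.+4%:R _ _ _ _ _ _ _ _ _ _ A B C D).
rewrite /w /t -!natr1; field; lra.
Qed.

(* 1 is a regular singular point of the equation, whose Taylor coefficients there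
   are determined by the value at 1. *)
Lemma gegen_op_eigen_inj mu k p : 0 < mu ->
  gegen_op mu p = k *: p -> p.[1] = 0 -> p = 0.
Proof.
move=> mu0 pk p1; pose q := p \Po ('X + 1).
have qE : - ('X * ('X + 2) * q^`()^`()) - (2 * mu + 1) *: (('X + 1) * q^`()) = k *: q.
  have : gegen_op mu p \Po ('X + 1) = k *: q by rewrite pk comp_polyZ.
  move=> <-; rewrite /gegen_op /q !deriv_comp !(derivD, derivX, derivC) addr0 !mulr1.
  rewrite deriv_comp !(derivD, derivX, derivC) addr0 !mulr1.
  apply: poly_ext => x.
  rewrite !(horner_comp, hornerD, hornerN, hornerZ, hornerM, hornerXn, hornerX, hornerC).
  by ring.
have qi i : q`_i = 0.
  elim: i => [|i IH].
    by rewrite -horner_coef0 /q horner_comp !hornerE ?add0r.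
  have := congr1 (fun f : {poly R} => f`_i) qE.
  have e1 : 'X * ('X + 2) * q^`()^`() = 'X * ('X * q^`()^`()) + 2%:R *: ('X * q^`()^`()).
    by rewrite scaler_nat; ring.
  have e2 : ('X + 1) * q^`() = 'X * q^`() + q^`() by ring.
  rewrite e1 e2 !(coefB, coefN, coefD, coefZ, coefXM, coef_deriv) IH mulr0.
  case: i IH => [|i] IH; rewrite /= ?IH.
    rewrite mulr1n => h; have : (2 * mu + 1) * q`_1 = 0 by lra.
    by move/eqP; rewrite mulf_eq0 => /orP[|/eqP//]; rewrite gt_eqF //; lra.
  have i0 : (0 : R) <= i%:R by [].
  (* Once the previous coefficient vanishes, the next one is multiplied by -(j + 2) (2 (j + 1) + 2
     mu + 1), which is nonzero for positive mu. *)
  have cancel j (u : R) : - (2 * (u *+ j.+2 *+ j.+1)) - (2 * mu + 1) * (u *+ j.+2) = 0 ->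
      u = 0.
    move=> h; have : (2 * (j.+2%:R * j.+1%:R) + (2 * mu + 1) * j.+2%:R) * u = 0.
      rewrite -[RHS]oppr0 -[in RHS]h -(mulr_natr _ j.+1) -(mulr_natr _ j.+2).
      ring.
    move/eqP; rewrite mulf_eq0 => /orP[|/eqP//].
    by rewrite gt_eqF // addr_gt0 // !mulr_gt0 //; lra.
  case: i i0 IH => [|i] i0 IH /=; rewrite ?(IH, mul0rn, mulr0, addr0, add0r) /=;
    exact: cancel.
apply: poly_ext => x; rewrite horner0.
have -> : p.[x] = q.[x - 1] by rewrite /q horner_comp !hornerE subrK.
have -> : q = 0 by apply/polyP => i; rewrite qi coef0.
by rewrite horner0.
Qed.

(** With the moments for [u] this is the average E[p(w + sqrt t X)]; with [translate_pow] for [u] it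
    is Gegenbauer's generalized translation of p. *)
Definition umbral (V : lmodType R) (u : nat -> V) p : V :=
  \sum_(k < size p) p`_k *: u k.

Lemma umbralE (V : lmodType R) (u : nat -> V) N p : (size p <= N)%N ->
  umbral V u p = \sum_(k < N) p`_k *: u k.
Proof.
move=> le_pN; rewrite /umbral (@big_ord_widen _ _ _ _ N (fun k => p`_k *: u k)) //.
rewrite big_mkcond; apply: eq_bigr => k _.
by case: ltnP => // le_pk; rewrite nth_default ?scale0r.
Qed.

Lemma umbral_is_linear (V : lmodType R) (u : nat -> V) : linear (umbral V u).
Proof.
move=> k p q; pose N := maxn (size p) (size q).
rewrite (umbralE _ _ N p) ?leq_maxl // (umbralE _ _ N q) ?leq_maxr //.
rewrite (umbralE _ _ N).
  rewrite scaler_sumr -big_split; apply: eq_bigr => i _.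
  by rewrite coefD coefZ scalerDl scalerA.
apply: leq_trans (size_polyD _ _) _; rewrite geq_max leq_maxr andbT.
by apply: leq_trans (size_scale_leq _ _) _; exact: leq_maxl.
Qed.

HB.instance Definition _ (V : lmodType R) (u : nat -> V) :=
  GRing.isLinear.Build R {poly R} V _ (umbral V u) (umbral_is_linear V u).

Lemma umbralXn (V : lmodType R) (u : nat -> V) n : umbral V u 'X^n = u n.
Proof.
rewrite (umbralE _ _ n.+1) ?size_polyXn // big_ord_recr /= coefXn eqxx scale1r.
by rewrite big1 ?add0r // => i _; rewrite coefXn ltn_eqF // scale0r.
Qed.

Lemma horner_umbral (u : nat -> {poly R}) p x :
  (umbral _ u p).[x] = umbral R^o (fun k => (u k).[x]) p.
Proof. by rewrite horner_sum; apply: eq_bigr => i _; rewrite hornerZ. Qed.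

Lemma linear_polyXn_eq (V : lmodType R) (F G : {linear {poly R} -> V}) :
  (forall n, F 'X^n = G 'X^n) -> F =1 G.
Proof.
move=> FG p; rewrite -[p]coefK poly_def !linear_sum.
by apply: eq_bigr => i _; rewrite !linearZ FG.
Qed.

Lemma gegen_op_Xn mu n : 0 < mu ->
  gegen_op mu 'X^n = (n%:R * n.-1%:R) *: 'X^(n.-2) - (n%:R * (n%:R + 2 * mu)) *: 'X^n.
Proof.
move=> mu0; have translate_powXn k : translate_pow 1 0 (mu - 1 / 2) k = 'X^k.
  by apply: poly_ext => x; rewrite horner_translate_pow mul0r moment_t0 mul1r hornerXn.
by have := gegen_op_translate_pow 1 0 mu n mu0; rewrite !translate_powXn expr1n addr0 mul1r.
Qed.

Lemma gegen_op_umbral a b mu p : 0 < mu -> a ^+ 2 + b = 1 ->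
  gegen_op mu (umbral _ (translate_pow a b (mu - 1 / 2)) p) =
  umbral _ (translate_pow a b (mu - 1 / 2)) (gegen_op mu p).
Proof.
move=> mu0 ab1; have E k := gegen_op_translate_pow a b mu k mu0.
have X k := gegen_op_Xn mu k mu0.
move: (mu - 1 / 2) E => nu E; set U := umbral _ _.
apply: (linear_polyXn_eq _ (gegen_op mu \o U) (U \o gegen_op mu)) => n /=.
by rewrite /U X linearB /= 2!linearZ /= !umbralXn E ab1 mul1r.
Qed.

Definition ngegen_poly mu n := translate_pow 1 (-1) (mu - 1 / 2) n.

Lemma horner_ngegen_poly mu n x : (ngegen_poly mu n).[x] = ngegen R mu n x.
Proof. by rewrite horner_translate_pow /ngegen; congr moment; ring. Qed.

Lemma ngegen_at1 mu n : ngegen R mu n 1 = 1.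
Proof. by rewrite /ngegen expr1n subrr moment_t0 expr1n. Qed.

(** The translate K of the eigenvector G by a is an eigenvector for the same eigenvalue, and its
    value at 1, where the random part vanishes, is G(a). By uniqueness K = G(a) G; evaluate at c. *)
Lemma ngegen_product mu n a c : 0 < mu ->
  umbral R^o (moment R (mu - 1 / 2) (a * c) ((1 - a ^+ 2) * (1 - c ^+ 2)))
    (ngegen_poly mu n) = ngegen R mu n a * ngegen R mu n c.
Proof.
move=> mu0; set G := ngegen_poly mu n.
pose K := umbral _ (translate_pow a (1 - a ^+ 2) (mu - 1 / 2)) G.
have eG : gegen_op mu G = - (n%:R * (n%:R + 2 * mu)) *: G.
  by rewrite gegen_op_translate_pow // expr1n subrr !mul0r scale0r add0r scaleNr.
have eK : gegen_op mu K = - (n%:R * (n%:R + 2 * mu)) *: K.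
  have ab : a ^+ 2 + (1 - a ^+ 2) = 1 by rewrite addrC subrK.
  by rewrite /K gegen_op_umbral // eG linearZ.
have K1 : K.[1] = G.[a].
  rewrite /K horner_umbral /umbral -[in RHS](coefK G) poly_def horner_sum.
  apply: eq_bigr => i _; rewrite horner_translate_pow hornerZ hornerXn.
  by rewrite expr1n subrr mulr0 mulr1 moment_t0.
have KE : K = G.[a] *: G.
  apply/eqP; rewrite -subr_eq0; apply/eqP.
  apply: (gegen_op_eigen_inj mu (- (n%:R * (n%:R + 2 * mu)))) => //.
    have -> : gegen_op mu (K - G.[a] *: G) = gegen_op mu K - G.[a] *: gegen_op mu G.
      by rewrite linearB linearZ.
    by rewrite eG eK scalerBr !scalerA [G.[a] * _]mulrC.
  have G1 : G.[1] = 1 by rewrite horner_ngegen_poly ngegen_at1.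
  by rewrite hornerD hornerN hornerZ K1 G1 mulr1 subrr.
rewrite -!horner_ngegen_poly -hornerZ -KE horner_umbral.
by congr umbral; apply/funext => k; rewrite horner_translate_pow.
Qed.

(** Integration by parts for E[Y p(Y)] with Y = w + sqrt t X, extending the recursion of [moment]
    from powers to polynomials. *)
Lemma umbral_mulX nu w t p :
  umbral R^o (moment R nu w t) ('X * p) = w * umbral R^o (moment R nu w t) p
    + t / (2 * (nu + 1)) * umbral R^o (moment R (nu + 1) w t) p^`().
Proof.
rewrite -[p]coefK poly_def mulr_sumr !linear_sum !mulr_sumr -big_split.
apply: eq_bigr => -[n _] _ /=; rewrite derivZ -scalerAr !linearZ /= -exprS derivXn.
rewrite linearMn /= !umbralXn; case: n => [|n].
  by rewrite /= mulr0n scaler0 mulr0 addr0 /GRing.scale /=; ring.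
by rewrite momentSS /GRing.scale /= -mulr_natr; ring.
Qed.

(** X and -X have the same law, so z - (w + sqrt t X) is distributed as (z - w) + sqrt t X. *)
Lemma umbral_shift nu w t z n :
  umbral R^o (moment R nu w t) ((z%:P - 'X) ^+ n) = moment R nu (z - w) t n.
Proof.
elim/ltn_ind: n nu => -[|[|n]] IH nu.
- by rewrite expr0 -(expr0 'X) umbralXn.
- rewrite expr1 linearB /= -(expr1 'X) umbralXn -[z%:P]mulr1 mul_polyC linearZ /=.
  by rewrite -(expr0 'X) umbralXn /= /GRing.scale /= mulr1.
rewrite momentSS -(IH n.+1 (ltnSn _)) -(IH n (ltnW (ltnSn _))).
rewrite [in LHS]exprS mulrBl mul_polyC linearB linearZ /= umbral_mulX deriv_exp /=.
rewrite derivB derivC derivX sub0r mulN1r mulNrn linearN linearMn.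
by rewrite /GRing.scale /= -mulr_natr; ring.
Qed.

(** Average [ngegen_expansion] over x = a c + sqrt ((1 - a^2) (1 - c^2)) X: [umbral_shift] evaluates
    the left side and [ngegen_product] each term on the right. *)
Lemma moment_addition mu a c z n : 0 < mu ->
  moment R (mu - 1 / 2) (z - a * c) ((1 - a ^+ 2) * (1 - c ^+ 2)) n =
  \sum_(i < n.+1) 'C(n, i)%:R * expansion_weight R mu i
     * moment R (mu + i%:R) z 1 (n - i) * (ngegen R mu i a * ngegen R mu i c).
Proof.
move=> mu0; rewrite -umbral_shift.
have -> : (z%:P - 'X) ^+ n = \sum_(i < n.+1) ('C(n, i)%:R * expansion_weight R mu i
     * moment R (mu + i%:R) z 1 (n - i)) *: ngegen_poly mu i.
  apply: poly_ext => x; rewrite horner_exp hornerD hornerN hornerC hornerX.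
  rewrite (ngegen_expansion R mu) // horner_sum; apply: eq_bigr => i _.
  by rewrite hornerZ horner_ngegen_poly.
rewrite linear_sum; apply: eq_bigr => i _.
by rewrite linearZ /= ngegen_product.
Qed.

End ProductFormula.

(** * The hypergeometric series *)

Section Hypergeometric.
Variable R : realType.
Implicit Types (s x nu : R) (u w : nat -> R).

Lemma cvgn_series_bound u : cvgn (series u) -> exists M, forall n, series u n <= M.
Proof.
move=> /cvg_seq_bounded; rewrite /bounded_near => -[M [_ hM]].
exists (M + 1) => n; apply: le_trans (ler_norm _) _.
by apply: (hM (M + 1)); rewrite ?ltrDl.
Qed.

(** The partial sums satisfy W_(n+1) = U_(n+1) - x U_n, which is at least (1 - x) U_n because U is
    nondecreasing. A bound on W thus bounds U, and the limits follow. *)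
Lemma series_telescoped u w x : 0 <= x < 1 -> (forall n, 0 <= u n) ->
  w 0%N = u 0%N -> (forall n, w n.+1 = u n.+1 - x * u n) ->
  cvgn (series w) ->
  cvgn (series u) /\ (1 - x) * limn (series u) = limn (series w).
Proof.
move=> /andP[x0 x1] u0 w0 wS cw.
have swE n : series w n.+1 = series u n.+1 - x * series u n.
  rewrite !seriesEord /= big_ord_recl [in RHS]big_ord_recl w0 -addrA; congr (_ + _).
  by rewrite mulr_sumr -sumrB; apply: eq_bigr => i _; rewrite lift0 wS.
have ndu : nondecreasing_seq (series u) by exact: nondecreasing_series.
have [M hM] := cvgn_series_bound w cw.
have cu : cvgn (series u).
  apply: nondecreasing_is_cvgn => //; exists (M / (1 - x)) => _ [n _ <-].
  rewrite ler_pdivlMr ?subr_gt0 //; apply: le_trans (hM n.+1); rewrite swE.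
  by rewrite mulrBr mulr1 mulrC lerD2r ndu.
split=> //; apply/esym.
have cu' : [sequence series u n.+1]_n @ \oo --> limn (series u).
  by rewrite (cvg_shiftS (series u)).
have cw' : [sequence series w n.+1]_n @ \oo --> (1 - x) * limn (series u).
  rewrite (_ : [sequence series w n.+1]_n = [sequence series u n.+1]_n - x *: series u).
    by rewrite mulrBl mul1r; apply: cvgB => //; exact: cvgZr.
  by apply/funext => n; rewrite /= swE.
by apply/cvg_lim => //; move: cw'; rewrite (cvg_shiftS (series w)).
Qed.

(** The Taylor coefficients of (1 - x)^(-s) at 0. *)
Definition binomial_coef s n : R := pochhammer s n / n`!%:R.

Lemma binomial_coef_ge0 s n : 0 < s -> 0 <= binomial_coef s n.
Proof. by move=> s0; rewrite divr_ge0 // ltW // pochhammer_gt0. Qed.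

Lemma binomial_coefS s n :
  binomial_coef s n.+1 = binomial_coef (s + 1) n.+1 - binomial_coef (s + 1) n.
Proof.
rewrite /binomial_coef (pochhammer_recl R s) pochhammerS factS natrM.
have h1 := fact_natr_neq0 R n; have h2 : n.+1%:R != 0 :> R by rewrite pnatr_eq0.
by rewrite -!natr1 in h2 *; field; apply/andP.
Qed.

Lemma pseries_binomialS s x : 0 < s -> 0 <= x < 1 ->
  cvgn (pseries (binomial_coef s) x) ->
  cvgn (pseries (binomial_coef (s + 1)) x) /\
  (1 - x) * limn (pseries (binomial_coef (s + 1)) x)
  = limn (pseries (binomial_coef s) x).
Proof.
move=> s0 x01 cs; have s1 : 0 < s + 1 by rewrite addr_gt0.
apply: series_telescoped => // [n||n].
- by rewrite mulr_ge0 ?binomial_coef_ge0 // exprn_ge0 //; case/andP: x01.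
- by rewrite /= /binomial_coef !pochhammer0.
- by rewrite /= binomial_coefS exprS; ring.
Qed.

(** For s at most 1 the coefficients are at most 1 and a geometric series dominates;
    [pseries_binomialS] raises s by one. *)
Lemma is_cvg_pseries_binomial s x : 0 < s -> 0 <= x < 1 ->
  cvgn (pseries (binomial_coef s) x).
Proof.
have [k sk] : exists k, s <= k.+1%:R.
  exists (Num.truncn s); have [s0|s0] := leP 0 s.
    exact/ltW/truncnS_gt.
  by apply: le_trans (ltW s0) _.
elim: k s sk => [|k IH] s sk s0 x01.
  apply: (@series_le_cvg R _ (geometric 1 x)) => [n|n|n|].
  - by rewrite mulr_ge0 ?binomial_coef_ge0 // exprn_ge0 //; case/andP: x01.
  - by rewrite /= mul1r exprn_ge0 //; case/andP: x01.
  - rewrite /= ler_wpM2r ?exprn_ge0 //; first by case/andP: x01.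
    rewrite /binomial_coef ler_pdivrMr ?ltr0n ?fact_gt0 // mul1r.
    elim: n => [|n IH]; first by rewrite pochhammer0.
    rewrite pochhammerS factS natrM mulrC; apply: ler_pM => //.
    + by rewrite addr_ge0 // ltW.
    + by rewrite ltW // pochhammer_gt0.
    by rewrite -natr1 addrC lerD2l.
  - by apply: is_cvg_geometric_series; case/andP: x01 => x0 x1; rewrite ger0_norm.
have [s1|s1] := leP s 1; first by apply: IH => //; apply: le_trans s1 _; rewrite ler1n.
have s10 : 0 < s - 1 by rewrite subr_gt0.
have [|+ _] := pseries_binomialS (s - 1) x s10 x01; last by rewrite subrK.
by apply: IH => //; rewrite lerBlDr natr1.
Qed.

(** The sums g_s satisfy g_s' = s g_(s+1) and (1 - y) g_(s+1) = g_s, so g_s(y) (1 - y)^s has zero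
    derivative; it equals 1 at 0. *)
Lemma binomial_series s x : 0 < s -> 0 <= x < 1 ->
  limn (pseries (binomial_coef s) x) = (1 - x) `^ (- s).
Proof.
move=> s0 x01; have /andP[x0 x1] := x01.
pose g s y := limn (pseries (binomial_coef s) y).
have diffsE t : pseries_diffs (binomial_coef t) = t *: binomial_coef (t + 1).
  apply/funext => n.
  have -> : (t *: binomial_coef (t + 1)) n = t * (pochhammer (t + 1) n / n`!%:R) by [].
  rewrite /pseries_diffs /binomial_coef pochhammer_recl factS natrM.
  have h1 := fact_natr_neq0 R n.
  have h2 : n.+1%:R != 0 :> R by rewrite pnatr_eq0.
  by field; apply/andP.
have pseriesZ k c y : pseries (k *: c) y = k *: pseries c y.
  rewrite /pseries -seriesZ; congr series; apply/funext => n.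
  by rewrite -[RHS]/(k * (c n * y ^+ n)) mulrA.
(* Termwise differentiation up to x needs convergence at a point strictly between x and 1. *)
pose K := (1 + x) / 2.
have K01 : 0 <= K < 1 by apply/andP; split; rewrite /K; lra.
have s1 : 0 < s + 1 by rewrite addr_gt0.
have dg y : 0 <= y <= x -> is_derive y 1 (g s) (s * g (s + 1) y).
  move=> /andP[y0 yx].
  have -> : s * g (s + 1) y = limn (pseries (pseries_diffs (binomial_coef s)) y).
    rewrite diffsE pseriesZ limZr //; apply: is_cvg_pseries_binomial => //.
    by rewrite y0 (le_lt_trans yx).
  apply: (@pseries_snd_diffs R _ K).
  - exact: is_cvg_pseries_binomial.
  - by rewrite diffsE pseriesZ; apply: is_cvgZr; exact: is_cvg_pseries_binomial.
  - rewrite diffsE (_ : pseries_diffs _ = s *: pseries_diffs (binomial_coef (s + 1))).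
      rewrite diffsE !pseriesZ; do 2 apply: is_cvgZr.
      by apply: is_cvg_pseries_binomial => //; rewrite addr_gt0.
    by apply/funext => n; rewrite /pseries_diffs mulrCA.
  - by rewrite !ger0_norm // /K; lra.
pose f y := g s y * (1 - y) `^ s.
have df y : 0 <= y <= x -> is_derive y 1 f 0.
  move=> yx; have dgy := dg y yx; have /andP[y0 y1] := yx.
  have y2 : 0 < 1 - y by lra.
  have d1 : is_derive y 1 (fun z : R => 1 - z) (-1).
    by apply: is_derive_eq; ring.
  have d2 := @is_derive1_comp R (fun z => z `^ s) (fun z => 1 - z) y _ _
    (@is_derive1_powR R s (1 - y) y2) d1.
  have dM : is_derive y 1 f _ := is_deriveM dgy d2.
  apply: (is_derive_eq dM).
  have e : (1 - y) * g (s + 1) y = g s y.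
    apply: (pseries_binomialS _ _ _ _ _).2 => //; first by rewrite y0 /=; lra.
    by apply: is_cvg_pseries_binomial => //; rewrite y0 /=; lra.
  rewrite -e /GRing.scale /=.
  rewrite -(mulr_powRB1 (ltW y2) s0); ring.
have cf : {within `[0, x], continuous f}.
  apply: derivable_within_continuous => y; rewrite in_itv /= => /df d.
  exact: ex_derive.
have dfo y : y \in `]0, x[ -> is_derive y 1 f ((fun=> 0) y).
  by rewrite in_itv /= => /andP[/ltW y0 /ltW y1]; apply: df; rewrite y0.
have : f x = f 0.
  have [c _] := MVT_segment x0 dfo cf.
  by rewrite mul0r => /eqP; rewrite subr_eq0 => /eqP.
rewrite /f subr0 powR1 mulr1.
have -> : g s 0 = 1.
  rewrite /g; apply/cvg_lim => //; rewrite -(cvg_shiftS (pseries _ _)).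
  rewrite (_ : [sequence _]_n = fun=> 1); first exact: cvg_cst.
  apply/funext => n; rewrite /= /pseries seriesEord /= big_ord_recl expr0 mulr1.
  by rewrite big1 ?addr0 /binomial_coef ?pochhammer0 ?fact0 ?divr1 // => i _;
     rewrite lift0 expr0n mulr0.
move=> h; rewrite powRN; have p0 : (1 - x) `^ s != 0.
  by rewrite gt_eqF // powR_gt0 // subr_gt0.
by apply: (mulIf p0); rewrite mulVf.
Qed.

(** The summand of the hypergeometric series of Q_{nu-1/2}^{N+nu+1/2}(z), with x = 1 / z^2. *)
Definition hyp_term nu N x n : R :=
  pochhammer ((N%:R + 2 * nu + 1) / 2) n * pochhammer ((N%:R + 2 * nu + 2) / 2) n
  / (pochhammer (nu + 1) n * n`!%:R) * x ^+ n.

Lemma pochhammer_double s n :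
  pochhammer (s / 2) n * pochhammer ((s + 1) / 2) n
  = pochhammer s (2 * n) / 4 ^+ n.
Proof.
elim: n => [|n IH]; first by rewrite muln0 !pochhammer0 expr0 divr1 mulr1.
have -> : (2 * n.+1 = (2 * n).+2)%N by lia.
rewrite !pochhammerS mulrACA IH exprS -natr1 natrM.
have : (4 : R) ^+ n != 0 by rewrite expf_neq0.
by move: (4 ^+ n) => q q0; field.
Qed.

Lemma hyp_termE nu N x n : hyp_term nu N x n =
  pochhammer (N%:R + 2 * nu + 1) (2 * n) / 4 ^+ n
  / (pochhammer (nu + 1) n * n`!%:R) * x ^+ n.
Proof.
by rewrite /hyp_term -pochhammer_double (_ : N%:R + 2 * nu + 1 + 1 = N%:R + 2 * nu + 2) //; ring.
Qed.

(** The coefficients of (1 - x) F(N+2, nu) = F(N+1, nu) + (N+1) / (2 (nu+1)) x F(N, nu+1). This is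
    the recursion of [moment] at w = 1, t = x, since the exponent N + nu + 1/2 agrees for (N+1, nu)
    and (N, nu+1). *)
Lemma hyp_term_recurrence nu N x n : 0 <= nu ->
  hyp_term nu N.+2 x n.+1 - x * hyp_term nu N.+2 x n =
  hyp_term nu N.+1 x n.+1 + N.+1%:R / (2 * (nu + 1)) * x * hyp_term (nu + 1) N x n.
Proof.
move=> nu0; rewrite !hyp_termE.
have -> : (2 * n.+1 = (2 * n).+2)%N by lia.
have n0 : (0 : R) <= n%:R by []. have N0 : (0 : R) <= N%:R by [].
set A := N%:R + 2 * nu + 3.
have -> : N%:R + 2 * (nu + 1) + 1 = A by rewrite /A; ring.
have -> : N.+2%:R + 2 * nu + 1 = A by rewrite /A -!natr1; ring.
have -> : N.+1%:R + 2 * nu + 1 = A - 1 by rewrite /A -!natr1; ring.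
rewrite (pochhammer_recl R (A - 1)) subrK !pochhammerS factS natrM !exprS.
have q0 := pochhammer_gt0 R (nu + 1 + 1) n ltac:(lra).
have -> : pochhammer (nu + 1) n = (nu + 1) * pochhammer (nu + 1 + 1) n / (nu + 1 + n%:R).
  by rewrite -pochhammer_recl pochhammerS mulfK // gt_eqF //; lra.
have p4 : (4 : R) ^+ n != 0 by rewrite expf_neq0.
have f0 := fact_natr_neq0 R n.
rewrite natrM -natr1 /A; field.
rewrite p4 f0 /= !gt_eqF //; lra.
Qed.

Lemma hyp_term_ge0 nu N x n : 0 <= nu -> 0 <= x -> 0 <= hyp_term nu N x n.
Proof.
move=> nu0 x0; have N0 : (0 : R) <= N%:R by [].
rewrite mulr_ge0 ?exprn_ge0 // divr_ge0 // mulr_ge0 //.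
all: by rewrite ltW // pochhammer_gt0 //; lra.
Qed.

Lemma cvg_hyp_term nu N x : 0 <= nu -> 0 <= x < 1 ->
  cvgn (series (hyp_term nu N x)) /\
  limn (series (hyp_term nu N x)) =
    (1 - x) `^ (- (N%:R + nu + 1 / 2)) * moment R nu 1 x N.
Proof.
move=> + x01; have /andP[x0 x1] := x01.
elim/ltn_ind: N nu => -[|[|N]] IH nu nu0.
(* For N = 0 the second upper parameter equals the lower one and cancels; for N = 1 the first one
   does. *)
- have e : hyp_term nu 0 x = fun n => binomial_coef (nu + 1 / 2) n * x ^+ n.
    apply/funext => n; rewrite /hyp_term /binomial_coef.
    have -> : (0%:R + 2 * nu + 1) / 2 = nu + 1 / 2 :> R by field.
    have -> : (0%:R + 2 * nu + 2) / 2 = nu + 1 :> R by field.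
    have p0 := pochhammer_gt0 R (nu + 1) n ltac:(lra); have f0 := fact_natr_neq0 R n.
    by field; rewrite f0 gt_eqF.
  have s0 : 0 < nu + 1 / 2 by lra.
  rewrite e -/(pseries _ x); split; first exact: is_cvg_pseries_binomial.
  by rewrite binomial_series //= mulr1 add0r.
- have e : hyp_term nu 1 x = fun n => binomial_coef (nu + 1 / 2 + 1) n * x ^+ n.
    apply/funext => n; rewrite /hyp_term /binomial_coef.
    have -> : (1%:R + 2 * nu + 1) / 2 = nu + 1 :> R by field.
    have -> : (1%:R + 2 * nu + 2) / 2 = nu + 1 / 2 + 1 :> R by field.
    have p0 := pochhammer_gt0 R (nu + 1) n ltac:(lra); have f0 := fact_natr_neq0 R n.
    by field; rewrite f0 gt_eqF.
  have s0 : 0 < nu + 1 / 2 + 1 by lra.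
  rewrite e -/(pseries _ x); split; first exact: is_cvg_pseries_binomial.
  by rewrite binomial_series //= mulr1; congr (_ `^ (- _)); ring.
have [c1 l1] := IH N.+1 (ltnSn _) nu nu0.
have [c2 l2] := IH N (ltnW (ltnSn _)) (nu + 1) (addr_ge0 nu0 ler01).
pose k := N.+1%:R / (2 * (nu + 1)) * x.
pose v n := if n is n1.+1 then k * hyp_term (nu + 1) N x n1 else 0.
have cv : series v @ \oo --> k * limn (series (hyp_term (nu + 1) N x)).
  rewrite -(cvg_shiftS (series v)).
  rewrite (_ : [sequence _]_n = k *: series (hyp_term (nu + 1) N x)); first exact: cvgZr.
  apply/funext => n; rewrite /= seriesEord /= big_ord_recl /= add0r -[RHS]/(k * _) seriesEord.
  by rewrite mulr_sumr; apply: eq_bigr => i _.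
pose w := hyp_term nu N.+1 x + v.
have cw : series w @ \oo --> limn (series (hyp_term nu N.+1 x))
    + k * limn (series (hyp_term (nu + 1) N x)).
  by rewrite seriesD; apply: cvgD.
have [||||] := series_telescoped (hyp_term nu N.+2 x) w x x01.
- by move=> n; exact: hyp_term_ge0.
- by rewrite /w /= -[LHS]/(hyp_term nu N.+1 x 0 + 0) addr0 /hyp_term !pochhammer0.
- by move=> n; rewrite hyp_term_recurrence.
- by apply/cvg_ex; eexists; exact: cw.
move=> c3 l3; split=> //; have x10 : 1 - x != 0 by rewrite subr_eq0 gt_eqF.
apply: (mulfI x10); rewrite l3 (cvg_lim _ cw) // l1 l2 momentSS [in RHS]mulrA.
have -> : (1 - x) * (1 - x) `^ (- (N.+2%:R + nu + 1 / 2)) =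
    (1 - x) `^ (- (N.+1%:R + nu + 1 / 2)).
  have {1}-> : 1 - x = (1 - x) `^ 1 by rewrite powRr1 // subr_ge0 ltW.
  rewrite -powRD ?x10 ?implybT //; congr (_ `^ _).
  by rewrite -(natr1 N.+1); ring.
have -> : - (N%:R + (nu + 1) + 1 / 2) = - (N.+1%:R + nu + 1 / 2) :> R.
  by rewrite -(natr1 N); ring.
by rewrite /k; ring.
Qed.

End Hypergeometric.

(** * Values of the Gamma function *)

Section GammaFunction.
Variable R : realType.
Implicit Types (a c x t : R).
Let leb := @lebesgue_measure R.

Lemma powR_expR_le a : 0 <= a ->
  exists2 C, 0 < C & forall t, 0 <= t -> t `^ a * expR (- t) <= C * expR (- (1 / 2 * t)).
Proof.
move=> a0; set n := (Num.truncn a).+1.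
have an : a <= n%:R by exact/ltW/truncnS_gt.
have f0 : (0 : R) < n`!%:R by rewrite ltr0n fact_gt0.
(* The summand 1 serves t at most 1; the other one comes from exp(t/2) >= (t/2)^n / n!. *)
have C0 : (0 : R) < 1 + 2 ^+ n * n`!%:R by rewrite addr_gt0 // mulr_gt0.
exists (1 + 2 ^+ n * n`!%:R) => // t t0.
have -> : - t = - (1 / 2 * t) - (1 / 2 * t) by lra.
rewrite expRD mulrA ler_pM2r ?expR_gt0 //.
rewrite expRN ler_pdivrMr ?expR_gt0 //.
have e1 : 1 <= expR (1 / 2 * t) by rewrite -[X in X <= _]expR0 ler_expR; lra.
have [t1|t1] := leP t 1.
  apply: (@le_trans _ _ 1).
    rewrite [X in _ <= X](_ : 1 = 1 `^ a); last by rewrite powR1.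
    by apply: ge0_ler_powR => //; rewrite nnegrE.
  by rewrite -[leLHS]mul1r; apply: ler_pM => //; rewrite lerDl mulr_ge0 // ltW.
apply: (@le_trans _ _ (t ^+ n)).
  by rewrite -powR_mulrn //; apply: ler_powR => //; exact: ltW.
have := @expR_ge1Dxn R (1 / 2 * t) (Num.truncn a).
rewrite -/n => /(_ ltac:(lra)) h.
have : (1 / 2 * t) ^+ n / n`!%:R <= expR (1 / 2 * t) by lra.
rewrite ler_pdivrMr // exprMn expr_div_n expr1n => h2.
apply: (@le_trans _ _ (2 ^+ n * n`!%:R * expR (1 / 2 * t))); last first.
  by rewrite ler_pM2r ?expR_gt0 // lerDr.
have p0 : (0 : R) < 2 ^+ n by [].
have -> : t ^+ n = 2 ^+ n * (1 / 2 ^+ n * t ^+ n).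
  by rewrite mulrA mulrCA divff ?mulr1 ?mul1r // gt_eqF.
by rewrite -[leRHS]mulrA ler_pM2l // [leRHS]mulrC.
Qed.

Lemma cvg_expR_neg c : 0 < c -> expR (- (c * t)) @[t --> +oo] --> (0 : R).
Proof.
move=> c0; apply: (cvg_comp (fun t => c * t) (fun t => expR (- t))).
  exact: gt0_cvgMry.
exact: cvgr_expR.
Qed.

Lemma integral_expR_neg c : 0 < c ->
  (\int[leb]_(t in `[0%R, +oo[) (expR (- (c * t)))%:E = (1 / c)%:E)%E.
Proof.
move=> c0; pose F t := - (1 / c) * expR (- (c * t)).
have dF t : is_derive t 1 F (expR (- (c * t))).
  rewrite /F; apply: is_derive_eq; rewrite /GRing.scale /=; field; lra.
have ce : continuous (fun t : R => expR (- (c * t))).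
  move=> t; apply: continuous_comp; last exact: continuous_expR.
  by apply: continuousN; apply: continuousM; [exact: cvg_cst|exact: cvg_id].
rewrite (@ge0_continuous_FTC2y R _ F 0 0) //.
- by rewrite /F mulr0 oppr0 expR0 mulr1 -EFinB opprK add0r.
- exact: continuous_subspaceT.
- rewrite -[X in _ --> X](mulr0 (- (1 / c))); apply: cvgMr; exact: cvg_expR_neg.
- apply: cvg_at_right_filter; apply: differentiable_continuous.
  exact/derivable1_diffP.
- by move=> t _; rewrite derive1E; apply: derive_val.
Qed.

(* Adding C e^(-ct) to f1 - f2 makes it nonnegative, so the fundamental theorem for
   nonnegative integrands applies without any integrability hypothesis. *)
Lemma dominated_FTC2y (f1 f2 F : R -> R) (C c : R) : 0 < C -> 0 < c ->
  (forall t, 0 <= t -> 0 <= f1 t) -> (forall t, 0 <= t -> 0 <= f2 t) ->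
  (forall t, 0 <= t -> f2 t <= C * expR (- (c * t))) ->
  {within `[0, +oo[, continuous f1} -> {within `[0, +oo[, continuous f2} ->
  F t @[t --> +oo] --> (0 : R) -> F t @[t --> 0^'+] --> F 0 -> F 0 = 0 ->
  (forall t, 0 < t -> is_derive t 1 F (f1 t - f2 t)) ->
  (\int[leb]_(t in `[0%R, +oo[) (f1 t)%:E = \int[leb]_(t in `[0%R, +oo[) (f2 t)%:E)%E.
Proof.
move=> C0 c0 f10 f20 f2C cf1 cf2 Fy F0 F00 dF.
pose e t := C * expR (- (c * t)).
pose E t := - (C / c) * expR (- (c * t)).
have dE t : is_derive t 1 E (e t).
  rewrite /E /e; apply: is_derive_eq; rewrite /GRing.scale /=; field; lra.
have cE t : {for t, continuous E}.
  by apply: differentiable_continuous; exact/derivable1_diffP.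
have ce : continuous e.
  move=> t; have de : is_derive t 1 e (- (C * c) * expR (- (c * t))).
    by rewrite /e; apply: is_derive_eq; rewrite /GRing.scale /=; ring.
  by apply: differentiable_continuous; exact/derivable1_diffP.
have E0 : E 0 = - (C / c) by rewrite /E mulr0 oppr0 expR0 mulr1.
have Ey : E t @[t --> +oo] --> (0 : R).
  rewrite -[X in _ --> X](mulr0 (- (C / c))); apply: cvgMr; exact: cvg_expR_neg.
have cew : {within `[0, +oo[, continuous e} by exact: continuous_subspaceT.
have mitv : measurable (`[0, +oo[%classic : set R) by exact: measurable_itv.
have mE (f : R -> R) : {within `[0, +oo[, continuous f} ->
    measurable_fun (`[0%R, +oo[%classic : set R) f.
  by move=> cf; exact: subspace_continuous_measurable_fun.
have I1 : (\int[leb]_(t in `[0%R, +oo[) (e t)%:E = (C / c)%:E)%E.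
  rewrite (@ge0_continuous_FTC2y R _ E 0 0) //.
  - by rewrite E0 -EFinB opprK add0r.
  - by move=> t _; rewrite mulr_ge0 ?expR_ge0 // ltW.
  - by apply: cvg_at_right_filter; exact: cE.
  - by move=> t _; rewrite derive1E; apply: derive_val.
have I2 : (\int[leb]_(t in `[0%R, +oo[) (f1 t - f2 t + e t)%:E = (C / c)%:E)%E.
  have dG t : 0 < t -> is_derive t 1 (F + E) (f1 t - f2 t + e t).
    by move=> t0; apply: is_deriveD; exact: dF.
  rewrite (@ge0_continuous_FTC2y R _ (F + E) 0 0) //.
  - have -> : (F + E) 0 = - (C / c) by rewrite -[LHS]/(F 0 + E 0) F00 E0 add0r.
    by rewrite -EFinB opprK add0r.
  - by move=> t t0; have := f10 t t0; have := f2C t t0; rewrite /e; lra.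
  - move=> t; apply: cvgD; last exact: cew.
    by apply: cvgB; [exact: cf1|exact: cf2].
  - by rewrite -[X in _ --> X](addr0 0); exact: cvgD.
  - by move=> t t0; have := dG t t0 => -[].
  - by apply: cvgD => //; apply: cvg_at_right_filter; exact: cE.
  - move=> t; rewrite in_itv /= andbT => t0; rewrite derive1E.
    by have := dG t t0 => -[].
have e0 t : 0 <= e t by rewrite mulr_ge0 ?expR_ge0 // ltW.
have f1L t : `[0%R, +oo[%classic t -> (0 <= (f1 t)%:E)%E.
  by rewrite /= in_itv /= andbT lee_fin; exact: f10.
have f2L t : `[0%R, +oo[%classic t -> (0 <= (f2 t)%:E)%E.
  by rewrite /= in_itv /= andbT lee_fin; exact: f20.
have fL t : `[0%R, +oo[%classic t -> (0 <= (f1 t - f2 t + e t)%:E)%E.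
  rewrite /= in_itv /= andbT lee_fin => t0.
  by have := f10 t t0; have := f2C t t0; rewrite /e; lra.
have eL t : `[0%R, +oo[%classic t -> (0 <= (e t)%:E)%E.
  by move=> _; rewrite lee_fin mulr_ge0 ?expR_ge0 // ltW.
have cf : {within `[0, +oo[, continuous (fun t => f1 t - f2 t + e t)}.
  move=> t; apply: cvgD; last exact: cew.
  by apply: cvgB; [exact: cf1|exact: cf2].
have S1 := ge0_integralD leb mitv f1L ((measurable_EFinP _ _).2 (mE _ cf1)) eL
  ((measurable_EFinP _ _).2 (mE _ cew)).
have S2 := ge0_integralD leb mitv f2L ((measurable_EFinP _ _).2 (mE _ cf2)) fL
  ((measurable_EFinP _ _).2 (mE _ cf)).
have I3 : (\int[leb]_(t in `[0%R, +oo[) (f1 t)%:E + (C / c)%:E =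
           \int[leb]_(t in `[0%R, +oo[) (f2 t)%:E + (C / c)%:E)%E.
  rewrite -[in LHS]I1 -I2 -S1 -S2.
  by apply: eq_integral => t _; rewrite -!EFinD; congr EFin; ring.
by move: I3; move/(congr1 (fun u => u - (C / c)%:E)%E); rewrite !addeK.
Qed.

Let gammaf a t := t `^ a * expR (- t).

Lemma gammaf_ge0 a t : 0 <= gammaf a t.
Proof. by rewrite mulr_ge0 ?powR_ge0 ?expR_ge0. Qed.

Lemma cvg_gammaf_y a : 0 <= a -> gammaf a t @[t --> +oo] --> (0 : R).
Proof.
move=> /powR_expR_le [C C0 hC].
apply: (@squeeze_cvgr _ _ _ _ (fun=> 0) (fun t => C * expR (- (1 / 2 * t)))).
- near=> t; rewrite gammaf_ge0 /=; apply: hC; near: t; exact: nbhs_pinfty_ge.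
- exact: cvg_cst.
- rewrite -[X in _ --> X](mulr0 C); apply: cvgMr; apply: cvg_expR_neg; lra.
Unshelve. all: by end_near.
Qed.

Lemma is_derive_gammaf a t : 0 < t ->
  is_derive t 1 (gammaf a) (a * gammaf (a - 1) t - gammaf a t).
Proof.
move=> t0; have d1 := @is_derive1_powR R a t t0.
have d2 : is_derive t 1 (fun z : R => expR (- z)) (- expR (- t)).
  by apply: is_derive_eq; ring.
have d : is_derive t 1 (gammaf a) _ := is_deriveM d1 d2.
by apply: (is_derive_eq d); rewrite /gammaf /GRing.scale /=; ring.
Qed.

Lemma continuous_gammaf_gt0 a t : 0 < t -> {for t, continuous (gammaf a)}.
Proof.
move=> t0; have d := is_derive_gammaf a t t0.
by apply: differentiable_continuous; exact/derivable1_diffP.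
Qed.

Lemma cvg_gammaf_0 a : 0 <= a -> gammaf a t @[t --> 0^'+] --> gammaf a 0.
Proof.
move=> a0; rewrite /gammaf; apply: cvgM; last first.
  apply: cvg_at_right_filter; apply: continuous_comp; last exact: continuous_expR.
  exact: continuousN.
have [->|an0] := eqVneq a 0.
  rewrite (_ : (fun t : R => t `^ 0) = fun=> 1); last by apply/funext => t; rewrite powRr0.
  by rewrite powRr0; exact: cvg_cst.
by rewrite powR0 //; apply: powR_cvg0; rewrite lt_neqAle eq_sym an0.
Qed.

Lemma continuous_gammaf a : 0 <= a -> {within `[0, +oo[, continuous (gammaf a)}.
Proof.
move=> a0; apply/continuous_within_itvcyP; split; last exact: cvg_gammaf_0.
by move=> t; rewrite in_itv /= andbT; exact: continuous_gammaf_gt0.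
Qed.

Lemma measurable_gammaf a : measurable_fun setT (gammaf a).
Proof.
apply: measurable_funM; first exact: measurable_powR.
by apply: measurableT_comp => //; exact: measurableT_comp.
Qed.

Lemma GammaE x : Gamma x = fine (\int[leb]_(t in `[0%R, +oo[) (gammaf (x - 1) t)%:E)%E.
Proof.
rewrite /Gamma /Rintegral integral_itv_obnd_cbnd //.
by apply/measurable_EFinP/measurable_funTS; exact: measurable_gammaf.
Qed.

(** Integrate the derivative of -t^x e^(-t). For x at least 1 both resulting integrands are
    continuous at 0, as [dominated_FTC2y] requires. *)
Lemma GammaS x : 1 <= x -> Gamma (x + 1) = x * Gamma x.
Proof.
move=> x1; have x0 : 0 < x by exact: lt_le_trans x1.
have a0 : 0 <= x - 1 by rewrite subr_ge0.
rewrite !GammaE addrK.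
have [C C0 hC] := powR_expR_le (x - 1) a0.
have -> : (\int[leb]_(t in `[0%R, +oo[) (gammaf x t)%:E =
    \int[leb]_(t in `[0%R, +oo[) (x * gammaf (x - 1) t)%:E)%E.
  apply: (@dominated_FTC2y _ _ (fun t => - gammaf x t) (x * C) (1 / 2)).
  - by rewrite mulr_gt0.
  - lra.
  - by move=> t _; rewrite gammaf_ge0.
  - by move=> t _; rewrite mulr_ge0 ?gammaf_ge0 // ltW.
  - by move=> t t0; rewrite -mulrA ler_pM2l //; exact: hC.
  - by apply: continuous_gammaf; exact: ltW.
  - by move=> t; apply: cvgMr; exact: continuous_gammaf.
  - by rewrite -oppr0; apply: cvgN; apply: cvg_gammaf_y; exact: ltW.
  - by apply: cvgN; apply: cvg_gammaf_0; exact: ltW.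
  - by rewrite /gammaf powR0 ?gt_eqF // mul0r oppr0.
  - move=> t t0; have d := is_deriveN (is_derive_gammaf x t t0).
    by apply: (is_derive_eq d); ring.
under eq_integral do rewrite EFinM.
rewrite ge0_integralZl_EFin //; last 3 first.
- by move=> t _; exact: gammaf_ge0.
- by apply/measurable_EFinP/measurable_funTS; exact: measurable_gammaf.
- exact: ltW.
have : (0 <= \int[leb]_(t in `[0%R, +oo[) (gammaf (x - 1) t)%:E)%E.
  by apply: integral_ge0 => t _; exact: gammaf_ge0.
case: (\int[leb]_(t in `[0%R, +oo[) (gammaf (x - 1) t)%:E)%E => [r||] //= _.
(* For an infinite integral both sides would be 0, the value of [fine] there. *)
by rewrite gt0_muley ?lte_fin // mulr0.
Qed.

Lemma Gamma1 : Gamma (1 : R) = 1.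
Proof.
rewrite GammaE subrr -[RHS]/(fine 1%:E); congr fine.
transitivity ((1 / 1 : R)%:E); last by rewrite divr1.
rewrite -(integral_expR_neg 1 ltr01); apply: eq_integral => t _.
by rewrite /gammaf powRr0 !mul1r.
Qed.

(** The difference between this integrand and the Gaussian is the derivative of -t exp(-t^2), which
    vanishes at 0 and at infinity. *)
Lemma integral_gauss_moment2 :
  (\int[leb]_(t in `[0%R, +oo[) (2 * t ^+ 2 * expR (- t ^+ 2))%:E =
   (Num.sqrt pi / 2)%:E)%E.
Proof.
rewrite -integral0y_gauss.
have g0 t : (0 : R) <= expR (- t ^+ 2) by exact: expR_ge0.
have gC (t : R) : 0 <= t -> expR (- t ^+ 2) <= expR 1 * expR (- (1 * t)).
  by move=> t0; rewrite -expRD ler_expR; have := sqr_ge0 (t - 1); lra.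
have d1 t : is_derive t 1 (fun z : R => expR (- z ^+ 2)) (- 2 * t * expR (- t ^+ 2)).
  by apply: is_derive_eq; rewrite /GRing.scale /=; ring.
have d2 t : is_derive t 1 (fun z : R => - (z * expR (- z ^+ 2)))
    (2 * t ^+ 2 * expR (- t ^+ 2) - expR (- t ^+ 2)).
  by apply: is_derive_eq; rewrite /GRing.scale /=; ring.
have d3 t : is_derive t 1 (fun z : R => 2 * z ^+ 2 * expR (- z ^+ 2))
    (4 * t * expR (- t ^+ 2) - 4 * t ^+ 3 * expR (- t ^+ 2)).
  by apply: is_derive_eq; rewrite /GRing.scale /=; ring.
pose F z : R := - (z * expR (- z ^+ 2)).
have cF : continuous F.
  move=> t; have dF : is_derive t 1 F _ := d2 t.
  by apply: differentiable_continuous; exact/derivable1_diffP.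
apply: (@dominated_FTC2y _ _ F (expR 1) 1).
- exact: expR_gt0.
- exact: ltr01.
- by move=> t _; rewrite mulr_ge0 // mulr_ge0 // sqr_ge0.
- by move=> t _; exact: g0.
- exact: gC.
- apply: continuous_subspaceT => t.
  by apply: differentiable_continuous; exact/derivable1_diffP.
- by apply: continuous_subspaceT; exact: continuous_gauss_fun.
- rewrite -oppr0; apply: cvgN.
  apply: (@squeeze_cvgr _ _ _ _ (fun=> 0) (fun t => expR 1 * gammaf 1 t)).
  + near=> t; have t0 : 0 <= t by near: t; exact: nbhs_pinfty_ge.
    rewrite mulr_ge0 //= /gammaf powRr1 // mulrCA ler_wpM2l //.
    by have := gC t t0; rewrite mul1r.
  + exact: cvg_cst.
  + by rewrite -[X in _ --> X](mulr0 (expR 1)); apply: cvgMr; exact: cvg_gammaf_y.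
- by apply: cvg_at_right_filter; exact: cF.
- by rewrite /F mul0r oppr0.
Unshelve. all: by end_near.
Qed.

(** Substitute t = s^2 on [0, n], with image [0, n^2], and let n tend to infinity. At 3/2, unlike
    1/2, the integrand is continuous at 0. *)
Lemma Gamma_32 : Gamma (3 / 2 : R) = Num.sqrt pi / 2.
Proof.
rewrite GammaE -[RHS]/(fine (Num.sqrt pi / 2)%:E) -integral_gauss_moment2; congr fine.
have -> : 3 / 2 - 1 = 1 / 2 :> R by field.
pose G := gammaf (1 / 2).
pose H t : R := 2 * t ^+ 2 * expR (- t ^+ 2).
have mH : measurable_fun setT H.
  apply: measurable_funM; last by apply: measurableT_comp => //; exact: measurableT_comp.
  by apply: measurable_funM => //; exact: exprn_measurable.
have H0 t : 0 <= H t by rewrite mulr_ge0 ?expR_ge0 // mulr_ge0 // sqr_ge0.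
have cG := @ge0_cvgn_integral R leb G (gammaf_ge0 _) (measurable_gammaf _).
have cH := @ge0_cvgn_integral R leb H H0 mH.
have sqinf : (fun n : nat => (n ^ 2)%N) @ \oo --> \oo.
  have le_sq (k : nat) : (k <= k ^ 2)%N by case: k => // k; rewrite expnS expn1 leq_pmulr.
  apply/cvgnyPge => A; near=> n; apply: leq_trans (le_sq n).
  by near: n; exact: nbhs_infty_ge.
have cG2 : (fun n : nat => (\int[leb]_(x in `[0%R, (n ^ 2)%:R]) (G x)%:E)%E) @ \oo -->
    (\int[leb]_(x in `[0%R, +oo[) (G x)%:E)%E := cvg_comp _ _ sqinf cG.
apply: (cvg_unique (@ereal_hausdorff R) cG2).
rewrite (_ : (fun n : nat => _) =
  fun n : nat => (\int[leb]_(x in `[0%R, n%:R]) (H x)%:E)%E); first exact: cH.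
apply/funext => n /=; pose F (t : R) := t ^+ 2.
have dF t : is_derive t 1 F (2 * t).
  by rewrite /F; apply: is_derive_eq; rewrite /GRing.scale /=; ring.
have cF : continuous F by exact: exprn_continuous.
have F'E : (derive1 F) = fun t => 2 * t.
  by apply/funext => t; rewrite derive1E; apply: derive_val.
have F'c : continuous (derive1 F).
  by rewrite F'E => t; exact: mulrl_continuous.
have := @integration_by_substitution_increasing R F G 0 n%:R.
rewrite /F expr0n /= -natrX => ->.
- apply: eq_integral => t; rewrite inE /= in_itv /= => /andP[t0 _].
  rewrite F'E /= /G /gammaf /H; congr EFin.
  rewrite -[LHS]/(_ * _) /=.
  have -> : (t ^+ 2) `^ (1 / 2) = t.
    by rewrite div1r powR12_sqrt ?sqr_ge0 // sqrtr_sqr ger0_norm.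
  by ring.
- by [].
- move=> a b; rewrite !in_itv /= => /andP[a0 _] /andP[b0 _] ab.
  by rewrite /F ltrXn2r.
- by move=> t _; exact: F'c.
- by apply/cvg_ex; eexists; apply: cvg_at_right_filter; exact: F'c.
- by apply/cvg_ex; eexists; apply: cvg_at_left_filter; exact: F'c.
- split.
  + by move=> t _; apply: ex_derive.
  + by apply: cvg_at_right_filter; exact: cF.
  + by apply: cvg_at_left_filter; exact: cF.
- apply: continuous_subspaceW (continuous_gammaf _ _) => [t /=|]; last lra.
  by rewrite !in_itv /= andbT => /andP[].
Unshelve. all: by end_near.
Qed.

Lemma Gamma_nat n : Gamma (n.+1%:R : R) = n`!%:R.
Proof.
elim: n => [|n IH]; first by rewrite Gamma1 fact0.
by rewrite -natr1 GammaS ?ler1n // IH factS natrM.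
Qed.

(** Passing from k to k + 1 exchanges the two arguments and raises one of them by 1. *)
Lemma Gamma_duplication k : (0 < k)%N ->
  Gamma ((k%:R + 1) / 2 : R) * Gamma (k%:R / 2 + 1 : R) * 2 ^+ k = Num.sqrt pi * k`!%:R.
Proof.
case: k => // k _; elim: k => [|k IH].
  have -> : (1%:R + 1) / 2 = 1 :> R by field.
  have -> : 1%:R / 2 + 1 = 3 / 2 :> R by field.
  by rewrite Gamma1 Gamma_32 factS fact0; field.
have -> : (k.+2%:R + 1) / 2 = k.+1%:R / 2 + 1 :> R by rewrite -(natr1 k.+1); field.
have -> : k.+2%:R / 2 + 1 = (k.+1%:R + 1) / 2 + 1 :> R by rewrite -(natr1 k.+1); field.
have k0 : (0 : R) <= k%:R by [].
rewrite (GammaS ((k.+1%:R + 1) / 2)); last by rewrite -natr1; lra.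
by rewrite exprS factS natrM [in RHS]mulrCA -IH -(natr1 k.+1); field.
Qed.

Lemma GammaD_nat x i : 1 <= x -> Gamma (x + i%:R) = Gamma x * pochhammer x i.
Proof.
move=> x1; elim: i => [|i IH]; first by rewrite addr0 /pochhammer big_ord0 mulr1.
rewrite /pochhammer big_ord_recr /= -/(pochhammer x i) -natr1 addrA GammaS; last first.
  by rewrite -[leLHS]addr0 lerD.
by rewrite IH; ring.
Qed.

End GammaFunction.

(** * Legendre functions with half-integer parameters *)

Section LegendreEvaluation.
Variable R : realType.
Implicit Types (mu x z : R).

Lemma gegenbauer_ngegen n mu x : 0 < mu ->
  gegenbauer n mu x = pochhammer (2 * mu) n / n`!%:R * ngegen R mu n x.
Proof.
move=> mu0; elim/ltn_ind: n => -[|[|n]] IH.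
- by rewrite /gegenbauer big_ord1 /= !pochhammer0 /ngegen /= !fact0; field.
- rewrite /gegenbauer big_ord1 /= !pochhammerS !pochhammer0 /ngegen /= !fact0.
  by rewrite factS fact0; field.
have := gegenbauer_recurrence R n mu x.
rewrite (IH n.+1) // (IH n) // => E; have E2 := ngegen_recurrence R mu x n mu0.
have n0 : (0 : R) <= n%:R by [].
have p0 := pochhammer_gt0 R (2 * mu) n ltac:(lra); have f0 := fact_natr_neq0 R n.
have n2 : n.+2%:R != 0 :> R by rewrite pnatr_eq0.
have -> : gegenbauer n.+2 mu x = (n.+2%:R * gegenbauer n.+2 mu x) / n.+2%:R.
  by rewrite mulrC mulKf.
rewrite E.
have -> : ngegen R mu n.+2 x = (2 * (n%:R + mu + 1) * x * ngegen R mu n.+1 x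
  - n.+1%:R * ngegen R mu n x) / (n%:R + 2 * mu + 1) by rewrite -E2; field; lra.
rewrite !pochhammerS !factS !natrM -!natr1; field.
by rewrite f0 /= !gt_eqF //; lra.
Qed.

Lemma cexpiD (a b : R) : cexpi (a + b) = cexpi a * cexpi b.
Proof. by rewrite /cexpi cosD sinD; apply/eqP; rewrite eq_complex /=; apply/andP; split; apply/eqP; ring. Qed.

Lemma cexpi_pi_nat n : cexpi (pi * n%:R) = ((-1) ^+ n)%:C%C :> R[i].
Proof.
elim: n => [|n IH]; first by rewrite mulr0 /cexpi cos0 sin0.
rewrite -natr1 mulrDr mulr1 cexpiD IH /cexpi cospi sinpi exprS.
by apply/eqP; rewrite eq_complex /=; apply/andP; split; apply/eqP; ring.
Qed.

(** Here the Gamma values are factorials. [cvg_hyp_term] at 1 / z^2 sums the series, and the powers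
    of z disappear by homogeneity: z^N P_N(1, 1/z^2) = P_N(z, 1). *)
Lemma legendreQ_moment (N k : nat) nu mu z : 1 < z ->
  nu = k%:R - 1 / 2 -> mu = N%:R + k%:R + 1 / 2 ->
  legendreQ nu mu z = cexpi (pi * mu) *
    (Num.sqrt pi / (2 `^ (1 / 2)) * (N + 2 * k)`!%:R / (2 ^+ k * k`!%:R)
      * (z ^+ 2 - 1) `^ (- (mu / 2)) * moment R k%:R z 1 N)%:C%C.
Proof.
move=> z1 nuE muE; rewrite /legendreQ; congr (_ * (_)%:C%C).
have z0 : 0 < z by lra. have z20 : 0 < z ^+ 2 by rewrite exprn_gt0.
have zz : 0 < z ^+ 2 - 1.
  by rewrite subr_gt0 -[ltLHS](expr1n R 2) ltrXn2r //= nnegrE ?ltW.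
pose x := 1 / z ^+ 2; have x01 : 0 <= x < 1.
  by rewrite /x divr_ge0 ?ltW //= ltr_pdivrMr // mul1r -subr_gt0.
have [_ H] := cvg_hyp_term R k%:R N x (ler0n _ _) x01.
have -> : nu + mu + 1 = (N + 2 * k).+1%:R.
  by rewrite nuE muE -(natr1 (N + 2 * k)) natrD natrM; field.
have -> : nu + mu + 2 = (N + 2 * k).+1%:R + 1.
  by rewrite nuE muE -(natr1 (N + 2 * k)) natrD natrM; field.
have -> : nu + 3 / 2 = k.+1%:R by rewrite nuE -(natr1 k); field.
have -> : hyp2F1 ((N + 2 * k).+1%:R / 2) (((N + 2 * k).+1%:R + 1) / 2) k.+1%:R x
   = limn (series (hyp_term R k%:R N x)).
  congr (limn (series _)); apply/funext => n; rewrite /hyp_term.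
  have -> : N%:R + 2 * k%:R + 1 = (N + 2 * k).+1%:R :> R by rewrite -(natr1 (N + 2 * k)) natrD natrM.
  have -> : N%:R + 2 * k%:R + 2 = (N + 2 * k).+1%:R + 1 :> R.
    by rewrite -(natr1 (N + 2 * k)) natrD natrM; ring.
  by rewrite (natr1 k).
rewrite H !(Gamma_nat R) -muE powR_mulrn ?ltW //.
have -> : 1 - x = (z ^+ 2 - 1) * (z ^+ 2) `^ (-1).
  by rewrite powR_inv1 ?ltW // mulrBl mulfV ?gt_eqF // /x.
rewrite powRM ?powR_ge0 ?ltW // -powRrM mulrNN.
have -> : (z ^+ 2) `^ (1 * mu) = z ^+ (2 * N + 2 * k + 1).
  rewrite -[z ^+ 2]powR_mulrn ?ltW // -powRrM -powR_mulrn ?ltW //; congr (_ `^ _).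
  by rewrite muE 2!natrD 2!natrM; field.
have -> : moment R k%:R z 1 N = z ^+ N * moment R k%:R 1 x N.
  have e : z ^+ 2 * x = 1 by rewrite /x mul1r mulfV // gt_eqF.
  by rewrite -moment_homog mulr1 e.
have -> : - mu = - (mu / 2) + - (mu / 2) by field.
rewrite [(z ^+ 2 - 1) `^ (_ + _)]powRD; last by rewrite (gt_eqF zz) implybT.
have -> : (z ^+ 2 - 1) `^ (mu / 2) = ((z ^+ 2 - 1) `^ (- (mu / 2)))^-1.
  by rewrite powRN invrK.
have -> : 2 `^ (nu + 1) = 2 ^+ k * 2 `^ (1 / 2) :> R.
  rewrite -powR_mulrn // -powRD ?pnatr_eq0 ?implybT //; congr (_ `^ _).
  by rewrite nuE; field.
have w0 : (z ^+ 2 - 1) `^ (- (mu / 2)) != 0 by rewrite gt_eqF // powR_gt0.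
have s0 : 2 `^ (1 / 2) != 0 :> R by rewrite gt_eqF // powR_gt0.
have k0 := fact_natr_neq0 R k; have t0 : 2 ^+ k != 0 :> R by rewrite expf_neq0.
have -> : (2 * N + 2 * k + 1 = (N + 2 * k).+1 + N)%N by lia.
rewrite exprD; move: (expf_neq0 N (lt0r_neq0 z0)) (expf_neq0 (N + 2 * k).+1 (lt0r_neq0 z0)).
move: (z ^+ N) (z ^+ (N + 2 * k).+1) (z ^+ 2) w0 => u v y.
move: (_ `^ (- (mu / 2))) (2 `^ (1 / 2)) s0 (2 ^+ k) t0 => a b b0 c c0 a0 u0 v0.
by field; rewrite ?(a0, b0, c0, u0, v0, k0).
Qed.

End LegendreEvaluation.

(** * One step of the nested sum *)

Section AdditionStep.
Variable R : realType.
Implicit Types (z c s t : R).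

(* The Gegenbauer index is e / 2 + l.  Normalized so that a summation against
   Theta d j lowers e by one at the sole cost of a factor (sin t sin t')^p / sqrt pi. *)
Definition normalized_moment p e l z : R :=
  (-1) ^+ l * moment R (l%:R + e%:R / 2) z 1 (p - l)
  / ((p - l)`!%:R * 2 ^+ l * Gamma (l%:R + e%:R / 2 + 1)).

Lemma pochhammer_nat q i : pochhammer (q.+1%:R : R) i * q`!%:R = (q + i)`!%:R.
Proof.
elim: i => [|i IH]; first by rewrite pochhammer0 mul1r addn0.
by rewrite pochhammerS mulrAC IH addnS factS natrM mulrC -natrD addSn.
Qed.

(** The two square roots coincide, so the product is free of them. Writing l = k + i and d - j = e +
    2 removes the truncated subtractions. *)
Lemma ThetaM d j e k i t t' : (d - j = e.+2)%N ->
  let mu : R := k%:R + e.+1%:R / 2 in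
  Theta d j (k + i) k t * Theta d j (k + i) k t' =
  Gamma (mu + 1) ^+ 2 / (2 * mu) ^+ 2 *
  (2 ^+ (2 * k + e.+1) * (2 * (mu + i%:R)) * i`!%:R / (pi * (i + (2 * k + e))`!%:R))
  * (sin t * sin t') ^+ k * (gegenbauer i mu (cos t) * gegenbauer i mu (cos t')).
Proof.
move=> dj mu; rewrite /Theta dj.
have -> : (e.+2 - 1 = e.+1)%N by lia.
have -> : (e.+2 - 2 = e)%N by lia.
have -> : (k + i - k = i)%N by lia.
have -> : (k + i + k + e = i + (2 * k + e))%N by lia.
have -> : k%:R + (e.+2 + 1)%:R / 2 = mu + 1 :> R.
  by rewrite /mu addn1 -(natr1 e.+2) -(natr1 e.+1); field.
have -> : (2 * k + e.+1)%:R = 2 * mu :> R by rewrite /mu natrD natrM; field.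
have -> : (2 * (k + i) + e.+1)%:R = 2 * (mu + i%:R) :> R.
  by rewrite /mu natrD natrM (natrD _ k); field.
rewrite -/mu; set S := _ / (pi * _).
have S0 : 0 <= S.
  rewrite divr_ge0 //; last by rewrite mulr_ge0 ?pi_ge0.
  by rewrite !mulr_ge0 // addr_ge0 // addr_ge0.
have [w wE SE] : exists2 w, Num.sqrt S = w & S = w ^+ 2.
  by exists (Num.sqrt S); rewrite ?sqr_sqrtr.
rewrite wE [in RHS]SE [(sin t * sin t') ^+ k]exprMn.
have mu0 : 0 < mu by rewrite /mu ltr_wpDl // divr_gt0.
by move: (sin t ^+ k) (sin t' ^+ k) => u v; field; rewrite gt_eqF.
Qed.

(** This is [moment_addition] at the two cosines, of degree p - k, with sin t sin t' extracted by
    homogeneity. The duplication formula at 2 mu = 2k + e + 1 matches the constants. *)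
Lemma sum_Theta_normalized_moment p d j e k t t' z : (d - j = e.+2)%N -> (k <= p)%N ->
  sin t != 0 -> sin t' != 0 ->
  \sum_(k <= l < p.+1) Theta d j l k t * Theta d j l k t' * normalized_moment p e.+1 l z =
  (Num.sqrt pi)^-1 * (sin t * sin t') ^+ p
  * normalized_moment p e k ((z - cos t * cos t') / (sin t * sin t')).
Proof.
move=> dj kp s0 s'0; pose mu : R := k%:R + e.+1%:R / 2; pose n := (p - k)%N.
have mu0 : 0 < mu by rewrite /mu ltr_wpDl // divr_gt0.
have muE : k%:R + e%:R / 2 = mu - 1 / 2 :> R by rewrite /mu -(natr1 e); field.
have pE : p = (n + k)%N by rewrite /n subnK.
have ss0 : sin t * sin t' != 0 by rewrite mulf_neq0.
have P0 : 0 < Num.sqrt pi :> R by rewrite sqrtr_gt0 pi_gt0.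
have PP : pi = Num.sqrt pi ^+ 2 :> R by rewrite sqr_sqrtr // pi_ge0.
pose q := (2 * k + e)%N.
have qE : q.+1%:R = 2 * mu :> R by rewrite /mu /q -(natr1 (2 * k + e)) natrD natrM -(natr1 e); field.
have dup := Gamma_duplication R q.+1 isT.
rewrite (_ : (q.+1%:R + 1) / 2 = mu + 1 / 2) in dup; last by rewrite qE; field.
rewrite (_ : q.+1%:R / 2 + 1 = mu + 1) in dup; last by rewrite qE; field.
(* The duplication formula has a nonzero right side, so neither Gamma factor vanishes. *)
have G12 : Gamma (mu + 1 / 2) != 0.
  apply: contra_neq (lt0r_neq0 (mulr_gt0 P0 (ltr0Sn R q.+1`!.-1))) => G0.
  by rewrite prednK ?fact_gt0 // -dup G0 !mul0r.
have G1 : Gamma (mu + 1) != 0.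
  apply: contra_neq (lt0r_neq0 (mulr_gt0 P0 (ltr0Sn R q.+1`!.-1))) => G0.
  by rewrite prednK ?fact_gt0 // -dup G0 mulr0 mul0r.
rewrite {2}/normalized_moment muE -/n (_ : mu - 1 / 2 + 1 = mu + 1 / 2); last by field.
have -> : (sin t * sin t') ^+ p = (sin t * sin t') ^+ k * (sin t * sin t') ^+ n.
  by rewrite -exprD pE addnC.
have M : (sin t * sin t') ^+ n * moment R (mu - 1 / 2)
    ((z - cos t * cos t') / (sin t * sin t')) 1 n =
    moment R (mu - 1 / 2) (z - cos t * cos t') ((1 - cos t ^+ 2) * (1 - cos t' ^+ 2)) n.
  rewrite -moment_homog mulrCA mulfV // !mulr1; congr moment.
  by rewrite -!sin2cos2 exprMn.
rewrite (moment_addition R mu) // in M.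
have -> : (Num.sqrt pi)^-1 * ((sin t * sin t') ^+ k * (sin t * sin t') ^+ n) *
  ((-1) ^+ k * moment R (mu - 1 / 2) ((z - cos t * cos t') / (sin t * sin t')) 1 n /
   (n`!%:R * 2 ^+ k * Gamma (mu + 1 / 2))) =
  (Num.sqrt pi)^-1 * (sin t * sin t') ^+ k * (-1) ^+ k
   / (n`!%:R * 2 ^+ k * Gamma (mu + 1 / 2)) *
  ((sin t * sin t') ^+ n *
   moment R (mu - 1 / 2) ((z - cos t * cos t') / (sin t * sin t')) 1 n) by ring.
rewrite M mulr_sumr -{1}[k]add0n big_addn big_mkord.
have -> : (p.+1 - k = n.+1)%N by rewrite /n subSn.
apply: eq_bigr => -[i /= i_le] _; rewrite ltnS in i_le.
rewrite (addnC i k) (ThetaM d j e) // -/mu -/q.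
rewrite !(gegenbauer_ngegen R i mu) // /normalized_moment.
have -> : (p - (k + i) = n - i)%N by rewrite /n subnDA.
have -> : (k + i)%:R + e.+1%:R / 2 = mu + i%:R :> R by rewrite /mu natrD; ring.
have -> : mu + i%:R + 1 = mu + 1 + i%:R by ring.
rewrite GammaD_nat; last by lra.
have -> : pochhammer (mu + 1) i = pochhammer mu i * (mu + i%:R) / mu.
  by rewrite -pochhammerS pochhammer_recl mulrC mulKf // gt_eqF.
have -> : 'C(n, i)%:R = n`!%:R / (i`!%:R * (n - i)`!%:R) :> R.
  by rewrite -(bin_fact i_le) !natrM mulfK // mulf_neq0 ?fact_natr_neq0.
have -> : ((i + q)`!%:R : R) = pochhammer (2 * mu) i * q`!%:R.
  by rewrite -qE pochhammer_nat addnC.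
have i0 : (0 : R) <= i%:R by [].
rewrite factS natrM qE in dup.
have -> : 2 ^+ (2 * k + e.+1) = Num.sqrt pi * (2 * mu * q`!%:R)
   / (Gamma (mu + 1 / 2) * Gamma (mu + 1)) :> R.
  by rewrite -dup /q addnS mulrC mulKf // mulf_neq0.
have -> : pi * (pochhammer (2 * mu) i * q`!%:R) =
    Num.sqrt pi ^+ 2 * (pochhammer (2 * mu) i * q`!%:R) by rewrite -PP.
rewrite /expansion_weight !exprD.
have := pochhammer_gt0 R mu i mu0; have := pochhammer_gt0 R (2 * mu) i ltac:(lra).
move: (pochhammer mu i) (pochhammer (2 * mu) i) => a b b0 a0.
move: (fact_natr_neq0 R n) (fact_natr_neq0 R i) (fact_natr_neq0 R (n - i)) (fact_natr_neq0 R q).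
move: (n`!%:R) (i`!%:R) ((n - i)`!%:R) (q`!%:R) => f1 f2 f3 f4 h1 h2 h3 h4.
have : 2 ^+ k != 0 :> R by rewrite expf_neq0.
have : 2 ^+ i != 0 :> R by rewrite expf_neq0.
move: (2 ^+ k) (2 ^+ i) (Gamma (mu + 1)) G1 (Gamma (mu + 1 / 2)) G12 => u v g g0 w w0 v0 u0.
move: (Num.sqrt pi) P0 => P P0.
field; rewrite ?(h1, h2, h3, h4, g0, w0, v0, u0) /= !gt_eqF //; lra.
Qed.

End AdditionStep.

(** * The nested sum *)

(** Induction on j, summing from the innermost index outwards: each sum lowers the order by 1/2 and
    moves the argument from z_j to z_(j+1). *)
Lemma nested_sum_normalized_moment (R : realType) (d p h : nat) (theta theta' : nat -> R)
    (f : nat -> R[i]) (z : nat -> R) (C : R[i]) (A : R) :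
  (forall j, (1 <= j <= h)%N -> sin (theta j) != 0) ->
  (forall j, (1 <= j <= h)%N -> sin (theta' j) != 0) ->
  (forall j, (j < h)%N -> z j.+1 =
    (z j - cos (theta j.+1) * cos (theta' j.+1)) / (sin (theta j.+1) * sin (theta' j.+1))) ->
  d = h.+2 ->
  (forall l, (l <= p)%N -> f l = C * (A * normalized_moment R p h l (z 0%N))%:C%C) ->
  forall j l, (j <= h)%N -> (l <= p)%N ->
  nested_sum p (Omega d theta theta') f j l =
  C * (A * (Num.sqrt pi) ^- j
       * (\prod_(1 <= k < j.+1) (sin (theta k) * sin (theta' k))) ^+ p
       * normalized_moment R p (h - j) l (z j))%:C%C.
Proof.
move=> s0 s0' zS dE fE; elim=> [|j IH] l jh lp.
  by rewrite [LHS]/= (fE l lp) expr0 invr1 mulr1 big_nil expr1n mulr1 subn0.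
rewrite [LHS]/=.
rewrite (eq_big_nat _ _ (F2 := fun k => C * ((A * (Num.sqrt pi) ^- j
  * (\prod_(1 <= k < j.+1) (sin (theta k) * sin (theta' k))) ^+ p)
  * (Theta d j.+1 k l (theta j.+1) * Theta d j.+1 k l (theta' j.+1)
     * normalized_moment R p (h - j) k (z j)))%:C%C)); last first.
  move=> k /andP[lk kp]; rewrite IH //; last exact: ltnW.
  rewrite mulrCA -rmorphM /Omega; congr (_ * (_)%:C%C).
  by ring.
rewrite -mulr_sumr -rmorph_sum -mulr_sumr; congr (_ * (_)%:C%C).
have -> : (h - j = (h - j.+1).+1)%N by lia.
rewrite (sum_Theta_normalized_moment R p d j.+1 (h - j.+1)) //; [|lia|by apply: s0; lia|by apply: s0'; lia].
rewrite -zS // [in RHS]big_nat_recr //= exprS invfM [in RHS]exprMn; ring.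
Qed.

Theorem theorem7p1 (R : realType) (d p m : nat) (x x' : 'rV[R]_d)
    (r r' : R) (theta theta' : nat -> R) (phi phi' : R) :
  (4 <= d)%N -> ~~ odd d -> (m <= p)%N ->
  is_polyspherical x r theta phi ->
  is_polyspherical x' r' theta' phi' ->
  0 < r -> 0 < r' ->
  0 < axial_radius d r theta -> 0 < axial_radius d r' theta' ->
  r != r' ->
  let rho := axial_radius d r theta in
  let rho' := axial_radius d r' theta' in
  let X := chi rho rho' x x' in
  let Z := zeta r r' in
  legendreQ (m%:R - 1 / 2) (p%:R + 1 / 2) X =
  ((-1) ^+ (d./2 - 1 + m) * (2 * pi) ^+ (d./2 - 1)
   * (X ^+ 2 - 1) `^ (- (p%:R / 2) - 1 / 4)
   * (p - m)`!%:R * (p + m)`!%:R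
   * (r * r' / (rho * rho')) ^+ p
   * ((Num.max r r' ^+ 2 - Num.min r r' ^+ 2) / (2 * r * r'))
       `^ (p%:R + (d%:R - 1) / 2))%:C%C
  * nested_sum p (Omega d theta theta')
      (fun l1 : nat =>
         ((-1) ^+ l1 / ((p - l1)`!%:R * (l1 + p + (d - 2))`!%:R))%:C%C
         * legendreQ (l1%:R + (d%:R - 3) / 2) (p%:R + (d%:R - 1) / 2) Z)
      (d - 2) m.
Proof.
move=> d4 dev mp [_ th _ xE] [_ th' _ xE'] r0 r0' rho0 rho0' rr' rho rho' X Z.
have [h dE] : exists h, d = (2 * h).+2.
  by exists (d./2 - 1)%N; have := odd_double_half d; rewrite (negbTE dev); lia.
have hE : (d - 2 = 2 * h)%N by lia.
have hE1 : (d - 1 = (2 * h).+1)%N by lia.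
have hE2 : (d./2 - 1 = h)%N by lia.
have dR : d%:R = 2 * h%:R + 2 :> R by rewrite dE -(natr1 (2 * h).+1) -(natr1 (2 * h)) natrM; ring.
(* [co] gives the j-th coordinate and [rad] the norm of the vector of coordinates after the j-th. *)
pose rad (s : R) (t : nat -> R) j := s * \prod_(1 <= k < j.+1) sin (t k).
pose co (s : R) (t : nat -> R) j := s * (\prod_(1 <= k < j) sin (t k)) * cos (t j).
have radS s t j : rad s t j.+1 = rad s t j * sin (t j.+1).
  by rewrite /rad big_nat_recr //= mulrA.
have coS s t j : co s t j.+1 = rad s t j * cos (t j.+1) by [].
have rhoE : rho = rad r theta (2 * h)%N by rewrite /rho /axial_radius hE1.
have rhoE' : rho' = rad r' theta' (2 * h)%N by rewrite /rho' /axial_radius hE1.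
have sin_gt0 s t : 0 < s -> (forall j, (1 <= j <= d - 2)%N -> 0 <= t j <= pi) ->
    0 < rad s t (2 * h)%N -> forall j, (1 <= j <= 2 * h)%N -> 0 < sin (t j).
  move=> s0 tj rad0 j jh; rewrite lt_neqAle eq_sym sin_ge0_pi ?tj ?hE // andbT.
  apply: contra_neq (lt0r_neq0 rad0) => sj; rewrite /rad.
  rewrite (big_cat_nat _ (n := j)) /=; [|lia|lia].
  by rewrite [X in _ * (_ * X)]big_ltn ?sj ?mul0r ?mulr0 //; lia.
have s_gt0 := sin_gt0 r theta r0 th ltac:(by rewrite -rhoE).
have s_gt0' := sin_gt0 r' theta' r0' th' ltac:(by rewrite -rhoE').
have rad_gt0 j : (j <= 2 * h)%N -> 0 < rad r theta j.
  elim: j => [|j IH] jh; first by rewrite /rad big_nil mulr1.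
  by rewrite radS mulr_gt0 ?IH ?s_gt0 //; lia.
have rad_gt0' j : (j <= 2 * h)%N -> 0 < rad r' theta' j.
  elim: j => [|j IH] jh; first by rewrite /rad big_nil mulr1.
  by rewrite radS mulr_gt0 ?IH ?s_gt0' //; lia.
(* These arguments interpolate between zeta at j = 0 and chi at j = d - 2. *)
pose z j := (r ^+ 2 + r' ^+ 2
    - 2 * \sum_(1 <= i < j.+1) co r theta i * co r' theta' i)
  / (2 * rad r theta j * rad r' theta' j).
have zS j : (j < 2 * h)%N -> z j.+1 = (z j - cos (theta j.+1) * cos (theta' j.+1))
    / (sin (theta j.+1) * sin (theta' j.+1)).
  move=> jh; rewrite /z big_nat_recr //= !radS !coS.
  have := s_gt0 j.+1 ltac:(lia); have := s_gt0' j.+1 ltac:(lia).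
  have := rad_gt0 j (ltnW jh); have := rad_gt0' j (ltnW jh).
  by move=> a b c e; field; rewrite !gt_eqF.
have z0 : z 0%N = Z.
  by rewrite /z /Z /zeta /rad !big_nil mulr0 subr0 !mulr1.
have pyth s t j : \sum_(1 <= i < j.+1) co s t i ^+ 2 = s ^+ 2 - rad s t j ^+ 2.
  elim: j => [|j IH]; first by rewrite /rad !big_nil mulr1 subrr.
  rewrite big_nat_recr //= IH coS radS !exprMn.
  by rewrite sin2cos2; ring.
have zX : z (2 * h)%N = X.
  rewrite /X /chi rhoE rhoE' /z; congr (_ / _).
  have -> : \sum_(i < d | (i < d - 2)%N) (x ord0 i - x' ord0 i) ^+ 2 =
    \sum_(1 <= i < (2 * h).+1) (co r theta i - co r' theta' i) ^+ 2.
    rewrite big_add1 /= big_mkord.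
    rewrite [RHS](@big_ord_widen _ _ _ _ d
      (fun i => (co r theta i.+1 - co r' theta' i.+1) ^+ 2)); last lia.
    rewrite hE; apply: eq_bigr => i ih; rewrite xE xE' !mxE /polyspherical_coord hE.
    by rewrite ih.
  rewrite [in RHS](eq_bigr (fun i => co r theta i ^+ 2 + co r' theta' i ^+ 2
    - 2 * (co r theta i * co r' theta' i))); last by move=> i _; ring.
  by rewrite sumrB big_split /= !pyth -mulr_sumr; ring.
have Zgt1 : 1 < Z.
  rewrite /Z /zeta ltr_pdivlMr ?mulr_gt0 // mul1r -subr_gt0.
  have -> : r ^+ 2 + r' ^+ 2 - 2 * r * r' = (r - r') ^+ 2 by ring.
  by rewrite exprn_even_gt0 //= subr_eq0.
(* z_(j+1) > 1 means that z_j exceeds the cosine of the difference of the two angles. *)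
have zgt1 j : (j <= 2 * h)%N -> 1 < z j.
  elim: j => [|j IH] jh; first by rewrite z0.
  have a := s_gt0 j.+1 ltac:(lia); have b := s_gt0' j.+1 ltac:(lia).
  rewrite zS // ltr_pdivlMr ?mulr_gt0 // mul1r.
  have := IH (ltnW jh); have := cos2Dsin2 (theta j.+1); have := cos2Dsin2 (theta' j.+1).
  have := sqr_ge0 (cos (theta j.+1) - cos (theta' j.+1)).
  have := sqr_ge0 (sin (theta j.+1) - sin (theta' j.+1)).
  by rewrite !sqrrB; lra.
have Xgt1 : 1 < X by rewrite -zX; exact: zgt1.
have P0 : 0 < Num.sqrt pi :> R by rewrite sqrtr_gt0 pi_gt0.
pose mu : R := p%:R + (d%:R - 1) / 2.
have fE l : (l <= p)%N ->
    ((-1) ^+ l / ((p - l)`!%:R * (l + p + (d - 2))`!%:R))%:C%C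
         * legendreQ (l%:R + (d%:R - 3) / 2) mu Z =
    cexpi (pi * mu) * ((Num.sqrt pi / 2 `^ (1 / 2) / 2 ^+ h * (Z ^+ 2 - 1) `^ (- (mu / 2)))
      * normalized_moment R p (2 * h) l (z 0%N))%:C%C.
  move=> lp; rewrite z0 (legendreQ_moment R (p - l) (l + h)) //; last 2 first.
  - by rewrite dR natrD; field.
  - by rewrite /mu dR natrD natrB //; field.
  rewrite mulrCA -rmorphM; congr (_ * (_)%:C%C).
  have -> : (p - l + 2 * (l + h) = l + p + (d - 2))%N by lia.
  rewrite /normalized_moment.
  have -> : l%:R + (2 * h)%:R / 2 = (l + h)%:R :> R by rewrite natrD natrM; field.
  rewrite natr1 Gamma_nat exprD.
  have := fact_natr_neq0 R (p - l); have := fact_natr_neq0 R (l + h).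
  have := fact_natr_neq0 R (l + p + (d - 2)).
  have : 2 ^+ l != 0 :> R by rewrite expf_neq0.
  have : 2 ^+ h != 0 :> R by rewrite expf_neq0.
  have : 2 `^ (1 / 2) != 0 :> R by rewrite gt_eqF // powR_gt0.
  move: (2 `^ (1 / 2)) (2 ^+ h) (2 ^+ l) => a b c a0 b0 c0.
  by move=> h1 h2 h3; field; rewrite ?(a0, b0, c0, h1, h2, h3).
rewrite -/mu.
rewrite (nested_sum_normalized_moment R d p (2 * h) theta theta' _ z _ _ _ _ zS dE fE) ?hE //; last 2 first.
- by move=> j jh; rewrite gt_eqF // s_gt0.
- by move=> j jh; rewrite gt_eqF // s_gt0'.
rewrite zX subnn (legendreQ_moment R (p - m) m) //; last first.
  by rewrite natrB //; field.
(* The orders of the two Legendre functions differ by the integer h = d/2 - 1. *)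
have -> : cexpi (pi * mu) = cexpi (pi * (p%:R + 1 / 2)) * ((-1) ^+ h)%:C%C.
  rewrite -cexpi_pi_nat -cexpiD -mulrDr; congr (cexpi (_ * _)).
  by rewrite /mu dR; field.
have pull (u v w : R) (e : R[i]) :
    u%:C%C * (e * v%:C%C * w%:C%C) = e * (u * (v * w))%:C%C.
  by rewrite !rmorphM /=; ring.
rewrite pull; congr (_ * (_)%:C%C).
(* The base is the square root of zeta^2 - 1, so this power cancels the one brought in by the inner
   Legendre functions. *)
have DE : ((Num.max r r' ^+ 2 - Num.min r r' ^+ 2) / (2 * r * r')) `^ mu
    = (Z ^+ 2 - 1) `^ (mu / 2).
  set D := (_ / _).
  have D0 : 0 <= D.
    rewrite /D divr_ge0 ?subr_ge0 //; last by rewrite !mulr_ge0 // ltW.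
    by rewrite lerXn2r ?nnegrE ?le_max ?le_min ?(ltW r0) ?(ltW r0') // ge_min lexx.
  have -> : Z ^+ 2 - 1 = D ^+ 2.
    rewrite /D /Z /zeta; case: (ltgtP r r') rr' => // _ _.
      by field; rewrite !gt_eqF.
    by field; rewrite !gt_eqF.
  by rewrite -[D ^+ 2]powR_mulrn // -powRrM; congr (_ `^ _); field.
rewrite DE hE2.
have -> : - (p%:R / 2) - 1 / 4 = - ((p%:R + 1 / 2) / 2) :> R by field.
have -> : (p - m + 2 * m = p + m)%N by lia.
have -> : \prod_(1 <= k < (2 * h).+1) (sin (theta k) * sin (theta' k)) = rho * rho' / (r * r').
  rewrite big_split /= rhoE rhoE' /rad; field; by rewrite !gt_eqF.
have W0 : (Z ^+ 2 - 1) `^ (- (mu / 2)) != 0.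
  by rewrite gt_eqF // powR_gt0 // subr_gt0 exprn_egt1.
have -> : (Z ^+ 2 - 1) `^ (mu / 2) = ((Z ^+ 2 - 1) `^ (- (mu / 2)))^-1.
  by rewrite powRN invrK.
rewrite /normalized_moment mul0r addr0 natr1 Gamma_nat.
have -> : (2 * pi) ^+ h = 2 ^+ h * Num.sqrt pi ^+ (2 * h) :> R.
  by rewrite exprMn exprM sqr_sqrtr // pi_ge0.
have -> : (rho * rho' / (r * r')) ^+ p = ((r * r' / (rho * rho')) ^+ p)^-1.
  by rewrite -exprVn invf_div.
have Q0 : (r * r' / (rho * rho')) ^+ p != 0.
  by rewrite expf_neq0 // gt_eqF // divr_gt0 // mulr_gt0.
rewrite exprD.
have sg n : (-1 : R) ^+ n * (-1) ^+ n = 1 by rewrite -exprMn mulrNN mulr1 expr1n.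
have h0 : 2 ^+ h != 0 :> R by rewrite expf_neq0.
have P2 : Num.sqrt pi ^+ (2 * h) != 0 :> R by rewrite expf_neq0 // gt_eqF.
have m2 : 2 ^+ m != 0 :> R by rewrite expf_neq0.
have t0 : 2 `^ (1 / 2) != 0 :> R by rewrite gt_eqF // powR_gt0.
have [a2 a2E n6] : exists2 a : R, 2 `^ (1 / 2) = a & a != 0 by exists (2 `^ (1 / 2)).
rewrite a2E.
move: (fact_natr_neq0 R (p - m)) (fact_natr_neq0 R m) (sg h) (sg m) h0 P2 m2 W0 Q0.
move: ((p - m)`!%:R) (m`!%:R) ((-1) ^+ h) ((-1) ^+ m) (2 ^+ h) (Num.sqrt pi ^+ (2 * h)).
move: (_ `^ (- ((_ + _) / 2))) (2 ^+ m) (_ `^ (- (mu / 2))) (_ ^+ p) ((p + m)`!%:R).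
move=> a5 a1 a3 a4 a6 b1 b2 b3 b4 b5 b6 n1 n2 e1 e2 n3 n4 n5 n7 n8.
(* The signs (-1)^h and (-1)^m each occur twice on the right; their squares are inserted on the
   left. *)
rewrite -[LHS]mul1r -[X in X * _ = _]mulr1 -{1}e1 -e2; field.
by rewrite ?(n1, n2, n3, n4, n5, n6, n7, n8).
Qed.
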